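(* Let $k$ be an algebraically closed field and let $A=kQ/I$ be a triangular finite-dimensional basic $k$-algebra whose Tits form $q_A$ is slender and admits a maximal omnipresent root $v$. Then $q_A$ is weakly non-negative. Moreover, $v(i)\le 12$ for every vertex $i\in Q_0$.
   Context: $A=kQ/I$ with $Q$ a finite quiver and $I$ an admissible ideal of the path algebra $kQ$; $A$ is triangular if $Q$ has no oriented cycles. For vertices $i,j$ let $I(i,j)$ be the part of $I$ spanned by (combinations of) paths from $i$ to $j$, and let $r(i,j)$ be the number of elements of $R\cap I(i,j)$, where $R$ is a minimal set of generators of $I$ contained in $\bigcup_{i,j}I(i,j)$. The Tits form is $q_A:\mathbb{Z}^{Q_0}\to\mathbb{Z}$, $q_A(v)=\sum_{i\in Q_0}v(i)^2-\sum_{(i\to j)\in Q_1}v(i)v(j)+\sum_{i,j\in Q_0}r(i,j)v(i)v(j)$. For a unit form $q(x)=\sum_i x_i^2+\sum_{i<j}q_{ij}x_ix_j$ on $\mathbb{Z}^n$, its symmetric bilinear form is $q(x,y)=q(x+y)-q(x)-q(y)$, so $q(e_i,e_j)=q_{ij}$ for $i\neq j$ ($e_i$ the canonical basis vectors). $q$ is slender if $q(e_i,e_j)\ge -1$ for all $i\ne j$. A root of $q$ is a vector $v\in\mathbb{Z}^n$ with non-negative coordinates and $q(v)=1$; it is omnipresent if $v(i)>0$ for all $i$, and maximal if every root $w\ge v$ (coordinatewise) satisfies $w=v$. $q$ is weakly non-negative if $q(v)\ge 0$ for all $v\in\mathbb{N}^n$. *)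

(* Defs.v *)
From HB Require Import structures.
From mathcomp Require Import all_boot all_order all_algebra.
From mathcomp Require Import boolp.
Set Implicit Arguments. Unset Strict Implicit. Unset Printing Implicit Defensive.
Import Order.TTheory GRing.Theory Num.Theory.
Local Open Scope ring_scope.

(* A finite quiver Q with vertex set 'I_n and arrow set 'I_m,
   source map [src] and target map [tgt].
   A (candidate) path is a pair (i, s) : starting vertex i and the sequence s
   of arrows, traversed left to right; (i, [::]) is the trivial path e_i. *)
Definition qpath (n m : nat) := ('I_n * seq 'I_m)%type.

Section PathAlgebra.
Variables (n m : nat) (src tgt : 'I_m -> 'I_n) (k : fieldType).

Definition endv (p : qpath n m) : 'I_n := last p.1 (map tgt p.2).

Definition valid_path (p : qpath n m) : bool :=
  match p.2 with
  | [::] => true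
  | a :: s => (src a == p.1) && path (fun a b => tgt a == src b) a s
  end.

(* Elements of the path algebra kQ are represented by their coefficient
   functions on paths: finitely supported, supported on valid paths. *)
Definition kQfun := qpath n m -> k.

Definition kQelem (x : kQfun) : Prop :=
  exists N : nat, forall p, x p != 0 -> valid_path p && (size p.2 < N)%N.

Definition kQzero : kQfun := fun _ => 0.
Definition kQadd (x y : kQfun) : kQfun := fun p => x p + y p.
Definition kQscale (c : k) (x : kQfun) : kQfun := fun p => c * x p.
(* multiplication = concatenation of paths, extended bilinearly *)
Definition kQmul (x y : kQfun) : kQfun := fun p =>
  \sum_(j < (size p.2).+1)
     x (p.1, take j p.2) * y (endv (p.1, take j p.2), drop j p.2).

Definition is_ideal (I : kQfun -> Prop) : Prop :=
  [/\ forall x, I x -> kQelem x,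
      I kQzero,
      forall x y, I x -> I y -> I (kQadd x y),
      forall c x, I x -> I (kQscale c x) &
      forall a x, kQelem a -> I x -> I (kQmul a x) /\ I (kQmul x a)].

Definition gen_ideal (S : kQfun -> Prop) (x : kQfun) : Prop :=
  forall I, is_ideal I -> (forall y, S y -> I y) -> I x.

(* admissible ideal: J^M <= I <= J^2 for some M >= 2, where J is the arrow
   ideal, so J^M is spanned by the paths of length >= M *)
Definition admissible (I : kQfun -> Prop) : Prop :=
  is_ideal I /\
  exists M : nat, (2 <= M)%N /\
    (forall x, kQelem x -> (forall p, (size p.2 < M)%N -> x p = 0) -> I x) /\
    (forall x, I x -> forall p, (size p.2 < 2)%N -> x p = 0).

Definition triangular : Prop :=
  forall p : qpath n m, valid_path p -> (0 < size p.2)%N -> endv p != p.1.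

Definition Iij (I : kQfun -> Prop) (i j : 'I_n) (x : kQfun) : Prop :=
  I x /\ forall p, x p != 0 -> p.1 = i /\ endv p = j.

Definition minimal_gen_set (I : kQfun -> Prop) (N : nat) (R : 'I_N -> kQfun)
  : Prop :=
  [/\ injective R,
      (forall l, exists i j, Iij I i j (R l)),
      (forall x, gen_ideal (fun y => exists l, y = R l) x <-> I x) &
      (forall l, ~ (forall x,
          gen_ideal (fun y => exists l', l' != l /\ y = R l') x <-> I x))].

Definition rel_count (I : kQfun -> Prop) (N : nat) (R : 'I_N -> kQfun)
  (i j : 'I_n) : nat :=
  #|[set l : 'I_N | `[< Iij I i j (R l) >] ]|.

End PathAlgebra.

Definition tits_form (n m : nat) (src tgt : 'I_m -> 'I_n)
  (r : 'I_n -> 'I_n -> nat) (v : 'I_n -> int) : int :=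
  \sum_(i < n) v i ^+ 2
  - \sum_(a < m) v (src a) * v (tgt a)
  + \sum_(i < n) \sum_(j < n) (r i j)%:Z * v i * v j.

Definition vadd (n : nat) (x y : 'I_n -> int) : 'I_n -> int := fun i => x i + y i.
Definition canon (n : nat) (i : 'I_n) : 'I_n -> int := fun j => (i == j)%:Z.
Definition bilin (n : nat) (q : ('I_n -> int) -> int) (x y : 'I_n -> int) : int :=
  q (vadd x y) - q x - q y.

Definition slender (n : nat) (q : ('I_n -> int) -> int) : Prop :=
  forall i j : 'I_n, i != j -> -1 <= bilin q (canon i) (canon j).

Definition is_root (n : nat) (q : ('I_n -> int) -> int) (v : 'I_n -> int) : Prop :=
  (forall i, 0 <= v i) /\ q v = 1.

Definition omnipresent (n : nat) (v : 'I_n -> int) : Prop := forall i, 0 < v i.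

Definition maximal_root (n : nat) (q : ('I_n -> int) -> int) (v : 'I_n -> int) : Prop :=
  is_root q v /\
  forall w, is_root q w -> (forall i, v i <= w i) -> forall i, w i = v i.

Definition weakly_nonneg (n : nat) (q : ('I_n -> int) -> int) : Prop :=
  forall v : 'I_n -> int, (forall i, 0 <= v i) -> 0 <= q v.

(* Main.v *)
Require Import Defs.
From HB Require Import structures.
From mathcomp Require Import all_boot all_order all_algebra.
From mathcomp Require Import boolp.
From mathcomp Require Import zify ring.
Import Order.TTheory GRing.Theory Num.Theory.
Local Open Scope ring_scope.
Set Implicit Arguments. Unset Strict Implicit. Unset Printing Implicit Defensive.

(* Write q(x, y) for the polar form. By maximality of v, applying reflections
   to v gives q(v, e_i) >= 0 for all i, and q(v, z) > 0 for every isotropic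
   z >= 0, z <> 0. If q took a negative value on a nonnegative vector, a
   shortest such vector x would have q(x) = -1 or -2, and a multiple of x, of
   x + e_i or of x - e_i added to v would be a larger root.

   For the bound, suppose M = v(w) > 12 and write v = M e_w + p_1 + ... + p_s
   with s minimal among nonnegative summands with p_i(w) = 0 and q(p_i) <= 1.
   Minimality makes all p_i roots with pairwise nonnegative products. As
   q(v, v) = 2, exactly two of them, a and b, have q(v, -) = 1; the others, the
   points p, satisfy q(v, p) = 0 and q(e_w, p) = -1. If a combination Y of e_w
   and points has q(Y, p) >= 0 for every point p, then q(Y, v) = 0 yields
   M q(Y, e_w) <= - q(Y, a) - q(Y, b), and weak nonnegativity bounds each term on
   the right by 6 q(Y, e_w), so M <= 12.

   Such a Y is found by taking the vector orthogonal to all points of a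
   configuration; a point with negative product with Y leads to a larger
   configuration. The process stays inside positive definite configurations:
   an infinite family of type D, treated by hand, and finitely many others
   ending with E_8, settled by certificates checked by computation. *)

(** * Integral quadratic forms and maximal roots *)

Section QuadraticForm.
Variables (n : nat) (C : 'M[int]_n).
Implicit Types x y z u : 'rV[int]_n.

(** [C] need not be symmetric; polarizing with [C + C^T] gives [bf x x = 2 * qf x], so everything
    stays integral. *)
Definition qf x : int := (x *m C *m x^T) 0 0.
Definition bf x y : int := (x *m (C + C^T) *m y^T) 0 0.
Definition nneg x : Prop := forall i, 0 <= x 0 i.
Notation unitv i := (delta_mx 0 i : 'rV[int]_n).

Lemma bfC x y : bf x y = bf y x.
Proof.
rewrite /bf -[in LHS](mxE trmx_key (fun i j => (x *m (C + C^T) *m y^T) j i) 0 0).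
by rewrite -/(trmx _) !trmx_mul trmxK linearD /= trmxK mulmxA addrC.
Qed.

Lemma bfDl x y z : bf (x + y) z = bf x z + bf y z.
Proof. by rewrite /bf !mulmxDl mxE. Qed.
Lemma bfDr x y z : bf z (x + y) = bf z x + bf z y.
Proof. by rewrite bfC bfDl !(bfC z). Qed.
Lemma bfNl x z : bf (- x) z = - bf x z.
Proof. by rewrite /bf !mulNmx mxE. Qed.
Lemma bfNr x z : bf z (- x) = - bf z x.
Proof. by rewrite bfC bfNl (bfC z). Qed.
Lemma bf0l z : bf 0 z = 0.
Proof. by rewrite /bf !mul0mx mxE. Qed.
Lemma bf0r z : bf z 0 = 0.
Proof. by rewrite bfC bf0l. Qed.
Lemma bfMnl x z k : bf (x *+ k) z = k%:Z * bf x z.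
Proof.
elim: k => [|k IH]; first by rewrite mulr0n bf0l mul0r.
by rewrite mulrS bfDl IH; lia.
Qed.
Lemma bfMnr x z k : bf z (x *+ k) = k%:Z * bf z x.
Proof. by rewrite bfC bfMnl (bfC z). Qed.
Definition bfE := (bfDl, bfDr, bfNl, bfNr, bfMnl, bfMnr, bf0l, bf0r).

Lemma bf_suml (T : Type) (s : seq T) (P : pred T) (F : T -> 'rV[int]_n) z :
  bf (\sum_(i <- s | P i) F i) z = \sum_(i <- s | P i) bf (F i) z.
Proof.
elim: s => [|i s IH]; first by rewrite !big_nil bf0l.
by rewrite !big_cons; case: (P i); rewrite ?bfDl IH.
Qed.
Lemma bf_sumr (T : Type) (s : seq T) (P : pred T) (F : T -> 'rV[int]_n) z :
  bf z (\sum_(i <- s | P i) F i) = \sum_(i <- s | P i) bf z (F i).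
Proof. by rewrite bfC bf_suml; apply: eq_bigr => i _; rewrite bfC. Qed.

Lemma bf_coord x y : bf x y = \sum_i y 0 i * bf x (unitv i).
Proof.
rewrite {1}[y]row_sum_delta bf_sumr; apply: eq_bigr => i _.
by rewrite /bf linearZ /= -scalemxAr mxE.
Qed.

Lemma bfxx x : bf x x = 2 * qf x.
Proof.
rewrite /bf /qf mulmxDr mulmxDl mxE.
suff -> : (x *m C^T *m x^T) 0 0 = (x *m C *m x^T) 0 0 by rewrite mulr2n mulrDl mul1r.
rewrite -[in RHS](mxE trmx_key (fun i j => (x *m C *m x^T) j i) 0 0) -/(trmx _).
by rewrite !trmx_mul trmxK mulmxA.
Qed.

Lemma qfD x y : qf (x + y) = qf x + qf y + bf x y.
Proof.
have := bfxx (x + y); rewrite !bfE (bfC y x) !bfxx; lia.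
Qed.
Lemma qf0 : qf 0 = 0.
Proof. by have := bfxx 0; rewrite bf0l; lia. Qed.
Lemma qfN x : qf (- x) = qf x.
Proof. by have := bfxx (- x); rewrite !bfE bfxx; lia. Qed.
Lemma qfMn x k : qf (x *+ k) = k%:Z * k%:Z * qf x.
Proof. by have := bfxx (x *+ k); rewrite !bfE bfxx; lia. Qed.
Definition qfE := (qfD, qfN, qfMn, bfDl, bfDr, bfNl, bfNr, bfMnl, bfMnr).

Lemma nnegD x y : nneg x -> nneg y -> nneg (x + y).
Proof. by move=> hx hy i; rewrite mxE addr_ge0. Qed.
Lemma nnegMn x k : nneg x -> nneg (x *+ k).
Proof. by move=> hx i; rewrite mulmxnE mulrn_wge0. Qed.
Lemma nneg0 : nneg 0.
Proof. by move=> i; rewrite mxE. Qed.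
Lemma nneg_sum (T : eqType) (s : seq T) (F : T -> 'rV[int]_n) :
  (forall i, i \in s -> nneg (F i)) -> nneg (\sum_(i <- s) F i).
Proof.
by move=> h; rewrite big_seq; apply: big_ind => //; [exact: nneg0|exact: nnegD].
Qed.
Lemma nneg_unitv i : nneg (unitv i).
Proof. by move=> j; rewrite mxE; case: (_ && _). Qed.
Lemma nneg_subunit x i : nneg x -> 0 < x 0 i -> nneg (x - unitv i).
Proof.
move=> hx hi j; rewrite !mxE eqxx /=; case: eqVneq => [->|_] /=; last first.
  by rewrite subr0.
by lia.
Qed.
Lemma nneg_neq0 x : nneg x -> x != 0 -> exists i, 0 < x 0 i.
Proof.
move=> hx x0; case: (boolP [exists i, x 0 i != 0]) => [/existsP[i hi]|/existsPn h].
  by exists i; rewrite lt_def hi hx.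
case/negP: x0; apply/eqP/rowP => i; rewrite mxE; apply/eqP.
by rewrite -[_ == _]negbK h.
Qed.

Lemma sum_coord_gt0 x : nneg x -> x != 0 -> 0 < \sum_j x 0 j.
Proof.
move=> hx /(nneg_neq0 hx)[i hi].
by rewrite (bigD1 i) //= ltr_pwDl // sumr_ge0.
Qed.

Lemma sum_coordB x i : \sum_j (x - unitv i) 0 j = \sum_j x 0 j - 1.
Proof.
rewrite (eq_bigr (fun j => x 0 j - (j == i)%:Z)) => [|j _]; last first.
  by rewrite !mxE eqxx /=; case: eqP.
rewrite sumrB; congr (_ - _); rewrite (bigD1 i) //= eqxx big1 // => j.
by move/negPf=> ->.
Qed.

(** * Weak nonnegativity from a maximal omnipresent root *)

Section MaximalRoot.
Hypothesis C1 : forall i, C i i = 1.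

Lemma bf_unitv i j : bf (unitv i) (unitv j) = C i j + C j i.
Proof. by rewrite /bf -rowE trmx_delta -colE !mxE. Qed.
Lemma qf_unitv i : qf (unitv i) = 1.
Proof. by have := bfxx (unitv i); rewrite bf_unitv C1; lia. Qed.

Hypothesis Cslender : forall i j, i != j -> -1 <= C i j + C j i.

(** The diagonal contributes 2 x_i; by slenderness every other coordinate contributes at least -
    x_j. *)
Lemma bf_unitv_ge x i : nneg x ->
  3 * x 0 i - \sum_j x 0 j <= bf x (unitv i).
Proof.
move=> hx; rewrite bfC bf_coord (bigD1 i) //= [X in _ <= X](bigD1 i) //=.
rewrite bfxx qf_unitv.
have : - (\sum_(j | j != i) x 0 j) <= \sum_(j | j != i) x 0 j * bf (unitv i) (unitv j).
  rewrite -sumrN; apply: ler_sum => j ji; rewrite bf_unitv.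
  have := Cslender ji; have := hx j; nia.
set A := \sum_(j | _) x 0 j; set B := \sum_(j | _) (_ * _) => h.
by rewrite -/A -/B in h *; lia.
Qed.

Variable v : 'rV[int]_n.
Hypothesis v_gt0 : forall i, 0 < v 0 i.
Hypothesis qv : qf v = 1.
Hypothesis v_max :
  forall w, nneg w -> qf w = 1 -> (forall i, v 0 i <= w 0 i) -> w = v.

Lemma nneg_v : nneg v. Proof. by move=> i; exact: ltW. Qed.

Lemma v_max_add x : nneg x -> qf (v + x) = 1 -> x = 0.
Proof.
move=> hx h; have : v + x = v; last first.
  by move/(canRL (addKr _)); rewrite addNr.
apply: v_max => // [|i]; first exact: nnegD nneg_v hx.
by rewrite mxE lerDl.
Qed.

Lemma bf_v_unitv_ge0 i : 0 <= bf v (unitv i).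
Proof.
rewrite leNgt; apply/negP => h.
have e : (`|bf v (unitv i)|%N)%:Z = - bf v (unitv i) by lia.
have := @v_max_add (unitv i *+ `|bf v (unitv i)|) (nnegMn _ (nneg_unitv i)).
rewrite !qfE qf_unitv qv e => /(_ ltac:(ring)) /rowP /(_ i).
by rewrite mulmxnE !mxE !eqxx /=; lia.
Qed.

Lemma bf_v_ge0 x : nneg x -> 0 <= bf v x.
Proof.
move=> hx; rewrite bf_coord; apply: sumr_ge0 => i _.
by rewrite mulr_ge0 ?bf_v_unitv_ge0.
Qed.

Lemma isotropic_eq0 x : nneg x -> qf x = 0 -> bf v x = 0 -> x = 0.
Proof. by move=> hx q0 b0; apply: v_max_add => //; rewrite qfD qv q0 b0. Qed.

(* A shortest nonnegative vector with [qf x < 0] has [qf x] equal to -1 or to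
   -2 (the complete graph on four vertices); both yield a root above [v]. *)
Lemma qf_ge0 x : nneg x -> 0 <= qf x.
Proof.
move=> hx; have [k] := ubnP (absz (\sum_j x 0 j)).
elim: k x hx => // k IH x hx hk; rewrite leNgt; apply/negP => qx.
have x0 : x != 0 by apply: contraTneq qx => ->; rewrite qf0.
have S0 := sum_coord_gt0 hx x0.
(* By minimality of x, q(x - e_i) = q(x) + 1 - q(x, e_i) is nonnegative. *)
have step i : 0 < x 0 i -> bf x (unitv i) <= 1 + qf x.
  move=> hi; have := IH (x - unitv i) (nneg_subunit hx hi).
  rewrite sum_coordB !qfE qf_unitv => /(_ ltac:(lia)); lia.
have := bfxx x; rewrite bf_coord => sum2.
have le_sum (c : int) : (forall i, 0 < x 0 i -> bf x (unitv i) <= c) ->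
    2 * qf x <= c * \sum_j x 0 j.
  move=> hc; rewrite -sum2 mulr_sumr; apply: ler_sum => i _.
  have := hx i; case: (ltrgt0P (x 0 i)) => // [hi _|-> _]; last by rewrite !(mul0r, mulr0).
  by have := hc i hi; nia.
have [i0 hi0] := nneg_neq0 hx x0.
have geS : 3 - \sum_j x 0 j <= 1 + qf x.
  have := step i0 hi0; have := bf_unitv_ge i0 hx; lia.
have leS := le_sum _ step.
have vx := bf_v_ge0 hx.
(* Equality in [step] makes x - e_i isotropic and orthogonal to v, hence zero; then x has coordinate
   sum 1, against [geS]. *)
have iso i : 0 < x 0 i -> bf v x = 0 -> bf x (unitv i) <> qf x + 1.
  move=> hi b0 bi; have nz := nneg_subunit hx hi.
  suff /rowP e : x - unitv i = 0.
    have := sum_coordB x i; rewrite big1 => [|j _]; last by rewrite e mxE.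
    by lia.
  apply: isotropic_eq0 => //; first by rewrite !qfE qf_unitv; lia.
  have := bf_v_ge0 nz; have := bf_v_unitv_ge0 i; rewrite !bfE; lia.
(* For such y, q(v + k' y) = 1, so maximality forces k' = 0. *)
have add y k' : nneg y -> y != 0 -> bf v y = - k'%:Z * qf y -> k' = 0%N.
  move=> hy y0 hb; apply/eqP; rewrite -[_ == _]negbK; apply/negP => k0.
  have := v_max_add (nnegMn k' hy); rewrite !qfE qv hb => /(_ ltac:(ring)) /rowP e.
  have [j hj] := nneg_neq0 hy y0; have /eqP := e j.
  by rewrite mulmxnE mxE mulrn_eq0 (negPf k0) /= gt_eqF.
have [q1|q1] := eqVneq (qf x) (- 1).
  have b0 : bf v x = 0.
    by have := add x (absz (bf v x)) hx x0; rewrite q1; lia.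
  have : 2 * qf x <= - 1 * \sum_j x 0 j.
    by apply: le_sum => i hi; have := step i hi; have := iso i hi b0; lia.
  lia.
(* With S the coordinate sum, S >= 2 - q(x) and 2 q(x) <= (1 + q(x)) S; for q(x) <= -2 these give
   (q(x) + 2)(q(x) - 1) <= 0. *)
have q2 : qf x = - 2 by nia.
have S4 : \sum_j x 0 j = 4 by nia.
(* The products q(x, e_i) on the support are at most -1, and their sum with weights x_i of total 4
   is 2 q(x) = -4. *)
have bx i : 0 < x 0 i -> bf x (unitv i) = - 1.
  move=> hi; apply/eqP; rewrite eq_le; apply/andP; split.
    by have := step i hi; lia.
  have : \sum_j x 0 j * (bf x (unitv j) + 1) = 0.
    under eq_bigr do rewrite mulrDr mulr1.
    by rewrite big_split /= sum2 S4 q2.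
  rewrite (bigD1 i) //=.
  have : \sum_(j | j != i) x 0 j * (bf x (unitv j) + 1) <= 0.
    apply: sumr_le0 => j _; have := hx j.
    case: (ltrgt0P (x 0 j)) => // [hj _|-> _]; last by rewrite mul0r.
    by have := step j hj; nia.
  by move: (\sum_(j | _) _) => A; nia.
have [b0|b0] := eqVneq (bf v x) 0.
  by apply: (iso i0 hi0 b0); rewrite bx // q2.
have [/dvdzP[t ht]|ho] := boolP (2 %| bf v x)%Z.
  by have := add x (absz (t)) hx x0; rewrite q2; lia.
(* When q(v, x) is odd, some x_i q(v, e_i) is odd; then q(x + e_i) = -2 and q(v, x + e_i) is even
   and positive. *)
have [i hi] : exists i, ~~ (2 %| (x 0 i * bf v (unitv i))%R)%Z.
  apply/existsP; rewrite -negb_forall; apply: contra ho => /forallP h.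
  by rewrite bf_coord; apply: rpred_sum => i _; apply: h.
have xi : 0 < x 0 i.
  by rewrite lt_def hx andbT; apply: contraNneq hi => ->; rewrite mul0r dvdz0.
have y0 : x + unitv i != 0.
  by apply/eqP => /rowP/(_ i); rewrite !mxE !eqxx /=; lia.
have hy := nnegD hx (nneg_unitv i).
have := add (x + unitv i) (absz (bf v (x + unitv i) %/ 2)%Z) hy y0.
rewrite !qfE qf_unitv bx // q2.
have := bf_v_unitv_ge0 i.
have : ~~ (2 %| bf v (unitv i))%Z by apply: contra hi; exact: dvdz_mull.
by lia.
Qed.

End MaximalRoot.
End QuadraticForm.

(** * Certificates for configurations of points *)

Section Certificates.
Local Open Scope nat_scope.

Definition dot (x y : seq nat) : nat := sumn [seq z.1 * z.2 | z <- zip x y].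
Definition quad (G : seq (seq nat)) (x : seq nat) : nat :=
  dot x [seq dot x r | r <- G].
Definition border (w : seq nat) (G : seq (seq nat)) : seq (seq nat) :=
  (2 :: w) :: [seq z.1 :: z.2 | z <- zip w G].
(** The index list may permute the points, so a known configuration is recognized in any order. *)
Definition minor (G : seq (seq nat)) (f : seq nat) : seq (seq nat) :=
  [seq [seq nth 0 (nth [::] G i) j | j <- f] | i <- f].

(** Enumerates the natural vectors w with [dot y w < m], all of them when the entries of [y] are
    positive. They are the candidate products of a new point with a configuration. *)
Fixpoint rows (y : seq nat) (m : nat) : seq (seq nat) :=
  if y is y0 :: y' then
    flatten [seq [seq w0 :: w | w <- rows y' (m - y0 * w0)]
            | w0 <- iota 0 m & y0 * w0 < m]
  else [:: [::]].

(* For points with Gram matrix [G], the vector with coefficient [z.1] at the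
   centre and [z.2] at the points has value
   [z.1 ^ 2 - z.1 * sumn z.2 + quad G z.2 / 2]. *)
Definition nonpos_at (G : seq (seq nat)) (z : nat * seq nat) : bool :=
  [&& 0 < z.1, size z.2 == size G
    & 2 * z.1 * z.1 + quad G z.2 <= 2 * z.1 * sumn z.2].
Definition neg_at (G : seq (seq nat)) (z : nat * seq nat) : bool :=
  (size z.2 == size G) && (2 * z.1 * z.1 + quad G z.2 < 2 * z.1 * sumn z.2).

(* [cert_center] and [cert_coef] are the coefficients of the vector Y at the
   centre and at the points. Every further point having negative product with Y
   must be excluded by a vector of [cert_nonpos], or produce a known
   configuration, selected by an index list in [cert_minors] (index 0 is the new
   point). [cert_neg] excludes the exceptional vectors violating the bound
   [- q(Y, a) <= 6 q(Y, E)]. *)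
Record certificate := Certificate {
  cert_gram : seq (seq nat);
  cert_center : nat;
  cert_coef : seq nat;
  cert_nonpos : seq (nat * seq nat);
  cert_neg : seq (nat * seq nat);
  cert_minors : seq (seq nat)
}.

Definition check_certificate (known : seq (seq (seq nat))) (c : certificate) :=
  let G := cert_gram c in let s := cert_center c in let y := cert_coef c in
  [&& all (ltn 0) y, size y == size G, sumn y < 2 * s &
    all (fun w =>
      let G' := border w G in
      (has (nonpos_at G') (cert_nonpos c)
       || has (fun f => all (gtn (size G')) f && (minor G' f \in known))
            (cert_minors c))
      && ((s <= dot y w + 6 * (2 * s - sumn y)) || has (neg_at G') (cert_neg c)))
    (rows y s)].

(** Each configuration may be reduced to earlier ones, so a list ends with the configuration from
    which the process starts. *)
Fixpoint check_all (known : seq (seq (seq nat))) (cs : seq certificate) : bool :=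
  if cs is c :: cs' then
    check_certificate known c && check_all (cert_gram c :: known) cs'
  else true.

Lemma rows_complete y w m : all (ltn 0) y -> size w = size y -> dot y w < m ->
  w \in rows y m.
Proof.
elim: y w m => [|y0 y IH] [|w0 w] m //= /andP[y0_gt0 y_gt0] [sw].
rewrite /dot /= -/(dot y w) => h.
apply/flattenP; exists [seq w0 :: r | r <- rows y (m - y0 * w0)].
  apply/mapP; exists w0 => //; rewrite mem_filter mem_iota add0n.
  by apply/andP; split; nia.
by apply: map_f; apply: IH => //; lia.
Qed.

End Certificates.

(** * Gram matrices of lists of vectors *)

Section Gram.
Variables (n : nat) (C : 'M[int]_n).
Implicit Types (cs ds : seq 'rV[int]_n) (x y p u : 'rV[int]_n).
Notation bf := (bf C).
Notation qf := (qf C).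

Definition vec (al : seq nat) cs : 'rV[int]_n :=
  \sum_(z <- zip al cs) z.2 *+ z.1.
Definition cross ds cs : seq (seq int) := [seq [seq bf d c | c <- cs] | d <- ds].
(** The entries of [G] are natural numbers, so nonnegativity of all products is built in. *)
Definition has_gram cs (G : seq (seq nat)) : Prop :=
  cross cs cs = map (map Posz) G.

Lemma has_gram_size cs G : has_gram cs G -> size G = size cs.
Proof. by move/(congr1 size); rewrite !size_map. Qed.

Lemma nneg_vec al cs : (forall c, c \in cs -> nneg c) -> nneg (vec al cs).
Proof.
move=> h; apply: nneg_sum => -[k c] /= /(map_f snd) /= hc.
apply/nnegMn/h; move: hc; rewrite -/(unzip2 _).
elim: al cs {h} => [|x al IH] [|d ds] //=; rewrite !inE.
by case/predU1P=> [->|/IH ->]; rewrite ?eqxx ?orbT.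
Qed.

Lemma bf_vec al cs w u :
  [seq bf c u | c <- cs] = map Posz w -> bf (vec al cs) u = dot al w.
Proof.
rewrite /vec bf_suml /dot.
elim: cs al w => [|c cs IH] [|k al] [|x w] //=; rewrite ?big_nil // => -[hx hw].
by rewrite big_cons (IH _ _ hw) /= bfMnl hx; lia.
Qed.

Lemma bf_vecr al ds cs H : cross ds cs = map (map Posz) H ->
  [seq bf d (vec al cs) | d <- ds] = map Posz [seq dot al r | r <- H].
Proof.
elim: ds H => [|d ds IH] [|r H] //= [hr hH]; rewrite (IH _ hH); congr (_ :: _).
rewrite bfC; apply: bf_vec; rewrite -hr.
by apply: eq_map => c; rewrite bfC.
Qed.

Lemma bf_vec_vec al cs G : has_gram cs G -> bf (vec al cs) (vec al cs) = quad G al.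
Proof. by move=> hG; apply/bf_vec/bf_vecr. Qed.

Lemma has_gram_border cs G p w : has_gram cs G ->
  [seq bf c p | c <- cs] = map Posz w -> qf p = 1 ->
  has_gram (p :: cs) (border w G).
Proof.
rewrite /has_gram /cross /= => hG hw qp; congr (_ :: _).
  rewrite bfxx qp -hw; congr (_ :: _).
  by apply: eq_map => c; rewrite bfC.
suff aux ds H t : cross ds cs = map (map Posz) H ->
    [seq bf c p | c <- ds] = map Posz t ->
    [seq bf d p :: [seq bf d c | c <- cs] | d <- ds]
    = map (map Posz) [seq z.1 :: z.2 | z <- zip t H] by exact: aux.
elim: ds H t => [|d ds IH] [|r H] [|x t] //= [hr hH] [hx ht].
by rewrite (IH _ _ hH ht) hr hx.
Qed.

Lemma has_gram_minor cs G f : has_gram cs G -> all (gtn (size G)) f ->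
  has_gram [seq nth 0 cs i | i <- f] (minor G f).
Proof.
move=> hG /allP hf; have sG := has_gram_size hG.
rewrite /has_gram /cross /minor -!map_comp.
apply/eq_in_map => i fi /=; rewrite -!map_comp; apply/eq_in_map => j fj /=.
have /= hi := hf i fi; have /= hj := hf j fj.
have row_size : size (nth [::] G i) = size cs.
  have := congr1 (fun s => size (nth [::] s i)) hG.
  by rewrite /cross (nth_map 0) -?sG // size_map (nth_map [::]) // size_map sG.
have := congr1 (fun s => nth 0 (nth [::] s i) j) hG.
rewrite /cross (nth_map 0) -?sG // (nth_map [::]) //.
by rewrite (nth_map 0) -?sG // (nth_map 0%N) // row_size -sG.
Qed.

End Gram.

(** * Star-shaped decompositions of a root *)

Section CertificateTables.
Local Open Scope nat_scope.

(* Configurations of type E, starting from [E6_gram] as last entry. The first one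
   spans the E_8 lattice, with Y the fundamental weight at the branch node. *)
Definition E_certificates : seq certificate := [::
  Certificate
    [:: [:: 2; 0; 0; 0; 0; 0; 0]; [:: 0; 2; 1; 0; 0; 0; 0];
        [:: 0; 1; 2; 0; 0; 0; 0]; [:: 0; 0; 0; 2; 1; 1; 1];
        [:: 0; 0; 0; 1; 2; 1; 1]; [:: 0; 0; 0; 1; 1; 2; 1];
        [:: 0; 0; 0; 1; 1; 1; 2]]
    30 [:: 15; 10; 10; 6; 6; 6; 6]
    [:: (6, [:: 1; 3; 2; 2; 1; 1; 1; 1]); (2, [:: 1; 1; 1; 0; 1; 0; 0; 0]);
        (2, [:: 1; 1; 0; 1; 1; 0; 0; 0]); (4, [:: 1; 2; 1; 1; 0; 1; 1; 1]);
        (4, [:: 1; 2; 1; 1; 1; 1; 0; 1]); (4, [:: 1; 2; 1; 1; 1; 0; 1; 1]);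
        (4, [:: 1; 2; 1; 1; 1; 1; 1; 0]); (3, [:: 1; 1; 1; 1; 1; 0; 0; 1]);
        (5, [:: 1; 2; 2; 1; 1; 1; 1; 1]); (2, [:: 1; 1; 1; 0; 0; 0; 1; 0]);
        (2, [:: 1; 1; 1; 0; 0; 0; 0; 1]); (5, [:: 1; 2; 1; 2; 1; 1; 1; 1]);
        (2, [:: 1; 1; 1; 0; 0; 1; 0; 0]); (3, [:: 1; 1; 1; 1; 0; 0; 1; 1]);
        (3, [:: 1; 1; 1; 1; 1; 0; 1; 0]); (2, [:: 1; 1; 0; 1; 0; 0; 0; 1]);
        (2, [:: 1; 1; 0; 1; 0; 0; 1; 0]); (3, [:: 1; 1; 1; 1; 0; 1; 1; 0]);
        (3, [:: 1; 1; 1; 1; 0; 1; 0; 1]); (2, [:: 1; 1; 0; 1; 0; 1; 0; 0]);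
        (3, [:: 1; 1; 1; 1; 1; 1; 0; 0])]
    [:: (8, [:: 2; 4; 2; 2; 2; 2; 2; 1]); (4, [:: 2; 2; 2; 1; 0; 0; 0; 2]);
        (6, [:: 2; 2; 2; 2; 2; 2; 0; 1]); (6, [:: 2; 2; 2; 2; 2; 0; 2; 1]);
        (6, [:: 2; 2; 2; 2; 0; 2; 2; 1]); (4, [:: 2; 2; 0; 2; 2; 0; 1; 0]);
        (4, [:: 2; 2; 2; 0; 0; 2; 0; 1]); (4, [:: 2; 2; 2; 0; 0; 2; 1; 0]);
        (4, [:: 2; 2; 2; 1; 0; 2; 0; 0]); (4, [:: 2; 2; 2; 1; 0; 0; 2; 0]);
        (4, [:: 2; 2; 0; 2; 2; 0; 0; 1]); (4, [:: 2; 2; 2; 0; 2; 0; 1; 0]);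
        (4, [:: 2; 2; 2; 0; 2; 0; 0; 1]); (4, [:: 2; 2; 2; 0; 0; 0; 2; 1]);
        (4, [:: 2; 2; 2; 0; 2; 1; 0; 0]); (4, [:: 2; 2; 0; 2; 0; 2; 1; 0]);
        (4, [:: 2; 2; 2; 1; 2; 0; 0; 0]); (4, [:: 2; 2; 0; 2; 0; 0; 2; 1]);
        (4, [:: 2; 2; 0; 2; 2; 1; 0; 0]); (6, [:: 2; 2; 2; 2; 2; 2; 1; 0]);
        (4, [:: 2; 2; 0; 2; 0; 2; 0; 1])]
    [::];
  Certificate
    [:: [:: 2; 0; 0; 1; 0; 0; 0]; [:: 0; 2; 1; 0; 0; 0; 0];
        [:: 0; 1; 2; 1; 0; 0; 0]; [:: 1; 0; 1; 2; 0; 0; 0];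
        [:: 0; 0; 0; 0; 2; 1; 1]; [:: 0; 0; 0; 0; 1; 2; 1];
        [:: 0; 0; 0; 0; 1; 1; 2]]
    20 [:: 8; 8; 4; 4; 5; 5; 5]
    [:: (5, [:: 1; 2; 2; 1; 1; 1; 1; 1]); (2, [:: 1; 1; 1; 0; 0; 0; 1; 0]);
        (2, [:: 1; 1; 1; 0; 0; 0; 0; 1]); (2, [:: 1; 0; 1; 0; 1; 1; 0; 0]);
        (2, [:: 1; 1; 0; 1; 0; 1; 0; 0]); (3, [:: 1; 1; 1; 0; 1; 0; 1; 1]);
        (4, [:: 1; 2; 1; 1; 0; 1; 1; 1]); (2, [:: 1; 0; 1; 0; 1; 0; 1; 0]);
        (4, [:: 1; 1; 1; 1; 1; 1; 1; 1]); (2, [:: 1; 0; 1; 0; 1; 0; 0; 1]);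
        (3, [:: 1; 1; 1; 0; 1; 1; 1; 0]); (2, [:: 1; 1; 1; 0; 0; 1; 0; 0]);
        (3, [:: 1; 1; 1; 1; 0; 0; 1; 1]); (3, [:: 1; 1; 1; 1; 0; 1; 1; 0]);
        (2, [:: 1; 1; 0; 1; 0; 0; 0; 1]); (2, [:: 1; 1; 0; 1; 0; 0; 1; 0]);
        (3, [:: 1; 1; 1; 1; 0; 1; 0; 1]); (3, [:: 1; 1; 1; 0; 1; 1; 0; 1]);
        (4, [:: 1; 1; 2; 0; 1; 1; 1; 1])]
    [:: (6, [:: 2; 2; 2; 0; 2; 2; 2; 1]); (6, [:: 2; 2; 2; 2; 0; 2; 2; 1]);
        (4, [:: 2; 2; 2; 1; 0; 0; 0; 2]); (4, [:: 2; 2; 2; 0; 1; 2; 0; 0]);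
        (4, [:: 2; 2; 2; 0; 1; 0; 2; 0]); (4, [:: 2; 2; 2; 0; 0; 2; 1; 0]);
        (4, [:: 2; 2; 0; 2; 0; 0; 2; 1]); (4, [:: 2; 0; 2; 0; 2; 2; 0; 1]);
        (4, [:: 2; 2; 0; 2; 0; 2; 1; 0]); (4, [:: 2; 0; 2; 0; 2; 2; 1; 0]);
        (4, [:: 2; 2; 2; 0; 0; 0; 2; 1]); (4, [:: 2; 2; 0; 2; 0; 2; 0; 1]);
        (4, [:: 2; 0; 2; 0; 2; 0; 2; 1]); (4, [:: 2; 2; 2; 0; 0; 2; 0; 1])]
    [:: [:: 1; 2; 3; 0; 5; 6; 7]; [:: 2; 1; 4; 0; 5; 6; 7]];
  Certificate
    [:: [:: 2; 0; 0; 0; 0; 0; 0]; [:: 0; 2; 0; 0; 1; 0; 1];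
        [:: 0; 0; 2; 1; 0; 1; 0]; [:: 0; 0; 1; 2; 0; 1; 0];
        [:: 0; 1; 0; 0; 2; 0; 1]; [:: 0; 0; 1; 1; 0; 2; 1];
        [:: 0; 1; 0; 0; 1; 1; 2]]
    14 [:: 7; 4; 4; 4; 4; 2; 2]
    [:: (3, [:: 1; 1; 1; 1; 1; 1; 0; 0]); (4, [:: 1; 2; 1; 1; 1; 1; 0; 1]);
        (2, [:: 1; 1; 1; 0; 0; 0; 1; 0]); (2, [:: 1; 1; 0; 0; 0; 1; 1; 0]);
        (3, [:: 1; 1; 1; 1; 1; 0; 0; 1]); (3, [:: 1; 1; 0; 1; 1; 1; 0; 1]);
        (3, [:: 1; 1; 1; 1; 0; 1; 1; 0]); (3, [:: 1; 1; 1; 0; 1; 1; 1; 0]);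
        (4, [:: 1; 2; 1; 1; 1; 1; 1; 0]); (2, [:: 1; 1; 1; 0; 1; 0; 0; 0]);
        (2, [:: 1; 1; 0; 0; 1; 0; 0; 1]); (2, [:: 1; 1; 0; 1; 0; 0; 0; 1]);
        (2, [:: 1; 1; 1; 1; 0; 0; 0; 0]); (2, [:: 1; 1; 0; 1; 0; 1; 0; 0]);
        (2, [:: 1; 1; 0; 0; 1; 1; 0; 0])]
    [:: (6, [:: 2; 2; 2; 2; 2; 2; 1; 0]); (4, [:: 2; 2; 2; 2; 0; 1; 0; 0]);
        (4, [:: 2; 2; 2; 0; 2; 1; 0; 0]); (4, [:: 2; 2; 2; 2; 1; 0; 0; 0]);
        (4, [:: 2; 2; 0; 2; 1; 2; 0; 0])]
    [:: [:: 1; 3; 4; 0; 2; 5; 7]; [:: 1; 5; 2; 0; 3; 4; 6];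
        [:: 1; 4; 3; 0; 2; 5; 7]; [:: 1; 2; 5; 0; 3; 4; 6]];
  Certificate
    [:: [:: 2; 0; 0; 0; 0; 0]; [:: 0; 2; 1; 0; 0; 0]; [:: 0; 1; 2; 0; 0; 0];
        [:: 0; 0; 0; 2; 1; 1]; [:: 0; 0; 0; 1; 2; 1]; [:: 0; 0; 0; 1; 1; 2]]
    12 [:: 6; 4; 4; 3; 3; 3]
    [:: (4, [:: 1; 2; 1; 1; 1; 1; 1]); (2, [:: 1; 1; 1; 0; 1; 0; 0]);
        (2, [:: 1; 1; 0; 1; 0; 0; 1]); (2, [:: 1; 1; 1; 0; 0; 1; 0]);
        (2, [:: 1; 1; 0; 1; 1; 0; 0]); (3, [:: 1; 1; 1; 1; 0; 1; 1]);
        (3, [:: 1; 1; 1; 1; 1; 0; 1]); (2, [:: 1; 1; 1; 0; 0; 0; 1]);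
        (2, [:: 1; 1; 0; 1; 0; 1; 0]); (3, [:: 1; 1; 1; 1; 1; 1; 0])]
    [:: (4, [:: 2; 2; 0; 2; 2; 1; 0]); (4, [:: 2; 2; 2; 1; 0; 2; 0]);
        (4, [:: 2; 2; 2; 1; 2; 0; 0]); (4, [:: 2; 2; 2; 0; 2; 1; 0])]
    [:: [:: 1; 3; 2; 0; 4; 5; 6]; [:: 1; 2; 5; 6; 3; 4; 0];
        [:: 1; 2; 4; 6; 3; 5; 0]; [:: 1; 2; 4; 5; 3; 6; 0];
        [:: 1; 2; 3; 0; 4; 5; 6]];
  Certificate
    [:: [:: 2; 1; 0; 0; 0; 0; 0]; [:: 1; 2; 0; 0; 0; 0; 0];
        [:: 0; 0; 2; 0; 0; 1; 1]; [:: 0; 0; 0; 2; 1; 0; 1];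
        [:: 0; 0; 0; 1; 2; 1; 0]; [:: 0; 0; 1; 0; 1; 2; 0];
        [:: 0; 0; 1; 1; 0; 0; 2]]
    12 [:: 4; 4; 3; 3; 3; 3; 3]
    [:: (3, [:: 1; 1; 1; 1; 1; 1; 0; 0]); (2, [:: 1; 0; 1; 0; 0; 0; 1; 1]);
        (2, [:: 1; 1; 0; 0; 1; 0; 1; 0]); (2, [:: 1; 1; 0; 0; 0; 1; 0; 1]);
        (2, [:: 1; 0; 1; 1; 1; 0; 0; 0]); (2, [:: 1; 0; 1; 1; 0; 1; 0; 0]);
        (4, [:: 1; 1; 1; 1; 1; 1; 1; 1]); (2, [:: 1; 1; 0; 0; 0; 0; 1; 1]);
        (2, [:: 1; 1; 0; 1; 1; 0; 0; 0]); (3, [:: 1; 1; 1; 1; 1; 0; 1; 0]);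
        (3, [:: 1; 1; 1; 0; 0; 1; 1; 1]); (3, [:: 1; 1; 1; 1; 0; 1; 0; 1]);
        (2, [:: 1; 0; 1; 0; 0; 1; 0; 1]); (2, [:: 1; 0; 1; 0; 1; 0; 1; 0]);
        (2, [:: 1; 1; 0; 1; 0; 1; 0; 0]); (3, [:: 1; 1; 1; 0; 1; 0; 1; 1])]
    [:: (4, [:: 2; 2; 1; 0; 2; 0; 2; 0]); (4, [:: 2; 2; 0; 2; 2; 1; 0; 0]);
        (4, [:: 2; 2; 1; 2; 0; 2; 0; 0]); (4, [:: 2; 0; 2; 2; 2; 1; 0; 0])]
    [:: [:: 5; 7; 3; 6; 0; 1; 2]; [:: 3; 5; 4; 7; 0; 1; 2];
        [:: 3; 4; 5; 6; 0; 1; 2]; [:: 4; 6; 3; 7; 0; 1; 2];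
        [:: 6; 7; 4; 5; 0; 1; 2]];
  Certificate
    [:: [:: 2; 0; 0; 1; 0; 0; 0]; [:: 0; 2; 1; 0; 0; 0; 0];
        [:: 0; 1; 2; 0; 0; 0; 1]; [:: 1; 0; 0; 2; 0; 1; 0];
        [:: 0; 0; 0; 0; 2; 1; 1]; [:: 0; 0; 0; 1; 1; 2; 1];
        [:: 0; 0; 1; 0; 1; 1; 2]]
    8 [:: 3; 3; 2; 2; 3; 1; 1]
    [:: (3, [:: 1; 1; 1; 1; 1; 1; 0; 0]); (2, [:: 1; 1; 1; 0; 0; 1; 0; 0]);
        (2, [:: 1; 0; 1; 0; 1; 0; 0; 1]); (2, [:: 1; 1; 0; 1; 0; 0; 1; 0]);
        (2, [:: 1; 0; 0; 1; 1; 1; 0; 0]); (3, [:: 1; 1; 1; 1; 0; 1; 1; 0]);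
        (3, [:: 1; 1; 1; 0; 1; 1; 0; 1]); (2, [:: 1; 0; 1; 0; 1; 1; 0; 0]);
        (2, [:: 1; 1; 1; 0; 0; 0; 1; 0]); (2, [:: 1; 1; 0; 1; 0; 1; 0; 0]);
        (2, [:: 1; 1; 1; 0; 0; 0; 0; 1])]
    [:: (4, [:: 2; 2; 2; 1; 0; 2; 0; 0])]
    [:: [:: 5; 2; 3; 0; 1; 4]; [:: 5; 1; 4; 0; 2; 3]; [:: 1; 2; 3; 0; 5; 6];
        [:: 1; 4; 0; 3; 7; 5; 2]; [:: 1; 0; 5; 6; 2; 7; 3];
        [:: 2; 0; 5; 7; 1; 6; 4]; [:: 2; 1; 4; 0; 5; 7];
        [:: 2; 3; 0; 4; 6; 5; 1]];
  Certificate
    [:: [:: 2; 1; 0; 0; 0; 0]; [:: 1; 2; 0; 0; 0; 0]; [:: 0; 0; 2; 0; 0; 1];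
        [:: 0; 0; 0; 2; 1; 0]; [:: 0; 0; 0; 1; 2; 1]; [:: 0; 0; 1; 0; 1; 2]]
    15 [:: 5; 5; 6; 6; 3; 3]
    [:: (2, [:: 1; 1; 0; 1; 1; 0; 0]); (2, [:: 1; 0; 1; 1; 1; 0; 0]);
        (2, [:: 1; 0; 1; 0; 1; 0; 1]); (2, [:: 1; 1; 0; 1; 0; 1; 0]);
        (2, [:: 1; 1; 0; 0; 1; 0; 1]); (3, [:: 1; 1; 1; 1; 1; 0; 1]);
        (2, [:: 1; 0; 1; 1; 0; 1; 0]); (3, [:: 1; 1; 1; 1; 1; 1; 0])]
    [:: (4, [:: 2; 2; 1; 2; 2; 0; 0])]
    [:: [:: 3; 4; 5; 0; 1; 2]; [:: 4; 1; 2; 0; 3; 6]; [:: 3; 1; 2; 0; 4; 5];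
        [:: 1; 2; 0; 5; 6; 3; 4]; [:: 2; 3; 6; 1; 4; 0; 5];
        [:: 4; 3; 6; 0; 1; 2]; [:: 1; 4; 5; 2; 3; 0; 6];
        [:: 1; 3; 6; 2; 4; 0; 5]; [:: 2; 4; 5; 1; 3; 0; 6]];
  Certificate
    [:: [:: 2; 1; 0; 0; 0]; [:: 1; 2; 0; 0; 0]; [:: 0; 0; 2; 1; 0];
        [:: 0; 0; 1; 2; 0]; [:: 0; 0; 0; 0; 2]]
    6 [:: 2; 2; 2; 2; 3]
    [:: (3, [:: 1; 1; 1; 1; 1; 1]); (2, [:: 1; 1; 0; 0; 1; 1]);
        (2, [:: 1; 0; 1; 1; 0; 1]); (2, [:: 1; 1; 0; 1; 0; 1]);
        (2, [:: 1; 0; 1; 0; 1; 1])]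
    [::]
    [:: [:: 1; 2; 3; 5; 0; 4]; [:: 5; 3; 4; 0; 1; 2]; [:: 3; 4; 2; 5; 0; 1];
        [:: 3; 4; 1; 5; 0; 2]; [:: 5; 1; 2; 0; 3; 4]; [:: 1; 2; 4; 5; 0; 3]]].

(* Configurations reached from [N_gram], the last entry. *)
Definition N_certificates : seq certificate := [::
  Certificate
    [:: [:: 2; 0; 0; 0; 0; 0]; [:: 0; 2; 0; 0; 1; 1]; [:: 0; 0; 2; 1; 0; 1];
        [:: 0; 0; 1; 2; 1; 0]; [:: 0; 1; 0; 1; 2; 0]; [:: 0; 1; 1; 0; 0; 2]]
    4 [:: 2; 1; 1; 1; 1; 1]
    [:: (2, [:: 1; 1; 1; 0; 1; 0; 0]); (2, [:: 1; 1; 0; 0; 0; 1; 1]);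
        (2, [:: 1; 1; 1; 1; 0; 0; 0]); (2, [:: 1; 1; 0; 0; 1; 0; 1]);
        (2, [:: 1; 1; 0; 1; 0; 1; 0])]
    [::]
    [:: [:: 0; 1; 2; 3; 4; 5]; [:: 1; 4; 0; 2; 6]; [:: 1; 2; 0; 3; 4];
        [:: 0; 1; 2; 4; 3; 6]; [:: 0; 1; 3; 5; 2; 6]; [:: 1; 3; 0; 2; 5];
        [:: 0; 1; 5; 6; 3; 4]; [:: 0; 1; 4; 6; 2; 5]];
  Certificate
    [:: [:: 2; 0; 0; 0; 0; 1; 1]; [:: 0; 2; 0; 0; 1; 0; 1];
        [:: 0; 0; 2; 1; 0; 1; 0]; [:: 0; 0; 1; 2; 1; 0; 0];
        [:: 0; 1; 0; 1; 2; 0; 0]; [:: 1; 0; 1; 0; 0; 2; 0];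
        [:: 1; 1; 0; 0; 0; 0; 2]]
    4 [:: 1; 1; 1; 1; 1; 1; 1]
    [:: (2, [:: 1; 0; 0; 0; 0; 1; 1; 1]); (2, [:: 1; 1; 1; 0; 1; 0; 0; 0]);
        (2, [:: 1; 1; 0; 1; 0; 1; 0; 0]); (2, [:: 1; 0; 0; 0; 1; 0; 1; 1]);
        (2, [:: 1; 0; 0; 1; 0; 1; 0; 1]); (2, [:: 1; 1; 1; 1; 0; 0; 0; 0]);
        (2, [:: 1; 0; 1; 0; 1; 0; 1; 0])]
    [::]
    [:: [:: 6; 7; 0; 4; 5]; [:: 2; 4; 0; 1; 6]; [:: 4; 6; 0; 2; 7];
        [:: 1; 2; 0; 3; 4]; [:: 3; 5; 0; 1; 7]; [:: 5; 7; 0; 3; 6];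
        [:: 1; 3; 0; 2; 5]];
  Certificate
    [:: [:: 2; 0; 0; 1; 0; 0]; [:: 0; 2; 1; 0; 0; 0]; [:: 0; 1; 2; 0; 0; 1];
        [:: 1; 0; 0; 2; 1; 0]; [:: 0; 0; 0; 1; 2; 1]; [:: 0; 0; 1; 0; 1; 2]]
    7 [:: 3; 3; 1; 1; 2; 2]
    [:: (2, [:: 1; 1; 1; 0; 0; 0; 1]); (2, [:: 1; 1; 1; 0; 0; 1; 0]);
        (2, [:: 1; 0; 1; 0; 1; 0; 1]); (2, [:: 1; 1; 0; 1; 0; 1; 0])]
    [::]
    [:: [:: 0; 1; 5; 6; 2]; [:: 1; 2; 0; 5; 6]; [:: 0; 2; 5; 6; 1];
        [:: 2; 0; 4; 5; 6; 1]; [:: 1; 0; 3; 6; 5; 2]; [:: 2; 3; 0; 1; 4; 5];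
        [:: 2; 6; 0; 1; 4]; [:: 0; 1; 2; 3; 5]; [:: 0; 3; 4; 5; 6; 1; 2];
        [:: 1; 4; 0; 2; 3; 6]; [:: 0; 2; 1; 4; 6]; [:: 1; 5; 0; 2; 3]];
  Certificate
    [:: [:: 2; 0; 0; 0; 0; 1]; [:: 0; 2; 0; 0; 1; 0]; [:: 0; 0; 2; 1; 0; 0];
        [:: 0; 0; 1; 2; 1; 1]; [:: 0; 1; 0; 1; 2; 1]; [:: 1; 0; 0; 1; 1; 2]]
    7 [:: 3; 3; 3; 1; 1; 1]
    [:: (2, [:: 1; 1; 1; 1; 0; 0; 0]); (2, [:: 1; 1; 0; 1; 0; 1; 0]);
        (2, [:: 1; 0; 1; 1; 0; 0; 1]); (2, [:: 1; 1; 1; 0; 1; 0; 0])]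
    [::]
    [:: [:: 0; 2; 3; 4; 1]; [:: 0; 3; 1; 6; 2]; [:: 0; 1; 3; 4; 2];
        [:: 0; 2; 1; 6; 3]; [:: 0; 1; 2; 5; 3]; [:: 1; 2; 0; 3; 4];
        [:: 1; 0; 4; 5; 2; 3]; [:: 0; 3; 2; 5; 1]; [:: 2; 0; 4; 6; 1; 3];
        [:: 1; 3; 0; 2; 5]; [:: 3; 0; 5; 6; 1; 2]; [:: 2; 3; 0; 1; 6]];
  Certificate
    [:: [:: 2; 1; 0; 0; 0]; [:: 1; 2; 0; 1; 0]; [:: 0; 0; 2; 1; 0];
        [:: 0; 1; 1; 2; 0]; [:: 0; 0; 0; 0; 2]]
    10 [:: 4; 2; 4; 2; 5]
    [:: (2, [:: 1; 1; 0; 1; 0; 1]); (2, [:: 1; 0; 1; 1; 0; 1]);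
        (2, [:: 1; 1; 0; 0; 1; 1])]
    [::]
    [:: [:: 0; 5; 1; 2; 3]; [:: 0; 5; 3; 4; 1]; [:: 0; 1; 3; 4; 5];
        [:: 1; 5; 0; 3; 4]; [:: 3; 5; 0; 4; 2; 1]; [:: 1; 5; 0; 2; 4; 3];
        [:: 1; 3; 5; 0; 4; 2]; [:: 5; 0; 2; 4; 3; 1]; [:: 0; 3; 1; 2; 5];
        [:: 3; 5; 0; 1; 2]]].

(** With the centre as branch node this is type E_6, with arms of lengths 2, 2 and 1. A point is a
    partial sum of simple roots along its arm, so points of one arm have product 1. *)
Definition E6_gram : seq (seq nat) :=
  [:: [:: 2; 1; 0; 0; 0]; [:: 1; 2; 0; 0; 0]; [:: 0; 0; 2; 1; 0];
      [:: 0; 0; 1; 2; 0]; [:: 0; 0; 0; 0; 2]].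
(** The products 1 among the first four points form a path, the comparability graph of the poset
    N. *)
Definition N_gram : seq (seq nat) :=
  [:: [:: 2; 1; 0; 0; 0]; [:: 1; 2; 0; 1; 0]; [:: 0; 0; 2; 1; 0];
      [:: 0; 1; 1; 2; 0]; [:: 0; 0; 0; 0; 2]].
Definition chain3_gram : seq (seq nat) :=
  [:: [:: 2; 0; 0; 0; 0]; [:: 0; 2; 0; 0; 0]; [:: 0; 0; 2; 1; 1];
      [:: 0; 0; 1; 2; 1]; [:: 0; 0; 1; 1; 2]].

Lemma E_certificates_valid : check_all [::] E_certificates.
Proof. by vm_compute. Qed.
Lemma E6_certified : E6_gram \in map cert_gram E_certificates.
Proof. by vm_compute. Qed.
(** [chain3_gram], of type D_6, has no certificate: it is supplied by the induction on the length of
    a chain. *)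
Lemma N_certificates_valid :
  check_all (chain3_gram :: map cert_gram E_certificates) N_certificates.
Proof. by vm_compute. Qed.
Lemma N_certified : N_gram \in map cert_gram N_certificates.
Proof. by vm_compute. Qed.

End CertificateTables.

(** * Bounding the coefficient of the centre *)

Section Star.
Variables (n : nat) (C : 'M[int]_n).
Notation bf := (bf C).
Notation qf := (qf C).
Hypothesis qf_ge0 : forall x, nneg x -> 0 <= qf x.

(** Otherwise (q(x) + 1) z + x would have value at most q(x) - (q(x) + 1) = -1. *)
Lemma isotropic_bf_ge0 z x : nneg z -> nneg x -> qf z = 0 -> 0 <= bf z x.
Proof.
move=> hz hx qz; rewrite leNgt; apply/negP => h.
have := qf_ge0 (nnegD (nnegMn (absz (qf x)).+1 hz) hx).
rewrite !qfE qz; have := qf_ge0 hx; nia.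
Qed.

Variables (M : nat) (E a b : 'rV[int]_n) (Pts : seq 'rV[int]_n).
Notation v := (E *+ M + a + b + \sum_(p <- Pts) p).
Hypothesis anisotropic : forall x, nneg x -> qf x = 0 -> bf v x = 0 -> x = 0.
Hypothesis E_nneg : nneg E.
Hypothesis qE : qf E = 1.
Hypothesis bvE : bf v E = 0.

Definition point p : Prop :=
  [/\ nneg p, qf p = 1, bf v p = 0, bf E p = - 1
    & forall p', p' \in Pts -> 0 <= bf p p'].
Definition exceptional p : Prop :=
  [/\ nneg p, qf p = 1, bf v p = 1, bf E p = - 1 \/ bf E p = - 2
    & forall p', p' \in Pts -> 0 <= bf p p'].

Hypothesis Pts_point : forall p, p \in Pts -> point p.
Hypothesis a_exceptional : exceptional a.
Hypothesis b_exceptional : exceptional b.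

Lemma Pts_nneg p : p \in Pts -> nneg p. Proof. by case/Pts_point. Qed.
Lemma Pts_qf p : p \in Pts -> qf p = 1. Proof. by case/Pts_point. Qed.
Lemma Pts_bfE p : p \in Pts -> bf E p = - 1. Proof. by case/Pts_point. Qed.
Lemma Pts_bfv p : p \in Pts -> bf v p = 0. Proof. by case/Pts_point. Qed.
Lemma Pts_bf p p' : p \in Pts -> p' \in Pts -> 0 <= bf p p'.
Proof. by case/Pts_point=> _ _ _ _; apply. Qed.

Lemma E_neq0 : E != 0.
Proof. by apply: contra_eq_neq qE => ->; rewrite qf0. Qed.

Lemma center_neq0 s x : (0 < s)%N -> nneg x -> E *+ s + x != 0.
Proof.
move=> s_gt0 hx; have [i hi] := nneg_neq0 E_nneg E_neq0.
apply/eqP => /rowP/(_ i)/eqP; rewrite !mxE mulmxnE.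
by rewrite gt_eqF // ltr_pwDl // pmulrn_lgt0.
Qed.

(** A vector of value 0 would be isotropic and orthogonal to [v], hence zero, although [E] occurs in
    it with a positive coefficient. *)
Lemma center_qf_gt0 s x : (0 < s)%N -> nneg x -> bf v x = 0 ->
  0 < qf (E *+ s + x).
Proof.
move=> s_gt0 hx bvx; have hy := nnegD (nnegMn s E_nneg) hx.
rewrite lt_def qf_ge0 // andbT; apply: contra_neq (center_neq0 s_gt0 hx) => q0.
by apply: anisotropic => //; rewrite bfDr bfMnr bvE bvx mulr0.
Qed.

Lemma bfv_vec al cs : {subset cs <= Pts} -> bf v (vec al cs) = 0.
Proof.
move=> hcs; rewrite bfC (@bf_vec _ _ _ _ (nseq (size cs) 0%N)).
  congr Posz; rewrite /dot; elim: al (size cs) => [|k al IH] [|m] //=.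
  by rewrite muln0 IH.
rewrite map_nseq; apply/(@eq_from_nth _ 0); first by rewrite size_map size_nseq.
move=> i; rewrite size_map => hi; rewrite nth_nseq hi (nth_map 0) //.
by rewrite bfC Pts_bfv // hcs // mem_nth.
Qed.

Lemma bfE_vec al cs : (forall c, c \in cs -> bf E c = - 1) ->
  size al = size cs -> bf E (vec al cs) = - (sumn al)%:Z.
Proof.
move=> hcs; rewrite /vec bf_sumr; elim: cs al hcs => [|c cs IH] [|k al] //= hcs.
  by rewrite big_nil.
move=> [hs]; rewrite big_cons IH // => [|d hd]; last by rewrite hcs // inE hd orbT.
by rewrite bfMnr hcs ?mem_head //=; lia.
Qed.

Lemma qf_center_vec cs G z : (forall c, c \in cs -> bf E c = - 1) ->
  has_gram C cs G -> size z.2 = size G ->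
  2 * qf (E *+ z.1 + vec z.2 cs) =
  (2 * z.1 * z.1 + quad G z.2)%:Z - (2 * z.1 * sumn z.2)%:Z.
Proof.
move=> hE hG hz; have := bf_vec_vec z.2 hG; rewrite bfxx => hq.
rewrite !qfE qE (bfE_vec hE) -?(has_gram_size hG) //; lia.
Qed.

Lemma not_nonpos_at cs G z : {subset cs <= Pts} -> has_gram C cs G ->
  nonpos_at G z = false.
Proof.
move=> hcs hG; apply/negP => /and3P[z_gt0 /eqP hz hle].
have hE c : c \in cs -> bf E c = - 1 by move/hcs/Pts_bfE.
have := qf_center_vec hE hG hz.
have := @center_qf_gt0 z.1 (vec z.2 cs) z_gt0 _ (bfv_vec _ hcs).
have h : nneg (vec z.2 cs) by apply: nneg_vec => c /hcs/Pts_nneg.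
move=> /(_ h); lia.
Qed.

Lemma not_neg_at cs G z : (forall c, c \in cs -> nneg c /\ bf E c = - 1) ->
  has_gram C cs G -> neg_at G z = false.
Proof.
move=> hcs hG; apply/negP => /andP[/eqP hz hlt].
have := qf_center_vec (fun c hc => (hcs c hc).2) hG hz.
have : nneg (E *+ z.1 + vec z.2 cs).
  by apply: nnegD; [exact: nnegMn|apply: nneg_vec => c /hcs[]].
by move/qf_ge0; lia.
Qed.

Lemma absz_bf cs p : (forall c, c \in cs -> 0 <= bf c p) ->
  [seq bf c p | c <- cs] = map Posz [seq absz (bf c p) | c <- cs].
Proof.
by move=> h; rewrite -map_comp; apply/eq_in_map => c /h /= ?; rewrite gez0_abs.
Qed.

(** Here E + p is isotropic, so its product with y is nonnegative. *)
Lemma exceptional_double p y : exceptional p -> bf E p = - 2 -> nneg y ->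
  - bf y p <= bf y E.
Proof.
case=> hp qp _ _ _ bEp hy.
have := @isotropic_bf_ge0 (E + p) y (nnegD E_nneg hp) hy.
rewrite !qfE qE qp bEp !(bfC _ y) => /(_ ltac:(lia)); lia.
Qed.

(* [v] is orthogonal to [y], and only [a] and [b] can have negative product
   with [y]. *)
Lemma bound_of_dominant y N : bf v y = 0 -> 0 < N -> bf y E = N ->
  (forall p, p \in Pts -> 0 <= bf y p) ->
  - bf y a <= 6 * N -> - bf y b <= 6 * N -> (M <= 12)%N.
Proof.
move=> bvy N_gt0 yE yP ya yb.
have : 0 <= \sum_(p <- Pts) bf y p by rewrite big_seq sumr_ge0.
move: bvy; rewrite bfC !bfDr bf_sumr bfMnr yE; nia.
Qed.

Section CertificateSound.
Variable known : seq (seq (seq nat)).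
Definition settled (G : seq (seq nat)) : Prop :=
  forall cs, {subset cs <= Pts} -> has_gram C cs G -> (M <= 12)%N.
Hypothesis known_settled : forall G, G \in known -> settled G.

(** If Y has nonnegative product with all points, [bound_of_dominant] applies. Otherwise a point
    with negative product is adjoined; its products form one of the checked rows, which is either
    impossible or leads to a known configuration. *)
Lemma certificate_settled c : check_certificate known c -> settled (cert_gram c).
Proof.
case: c => G s y K A F /and4P[/= y_gt0 /eqP sy s_big /allP rowsP] cs hcs hG.
have hE c : c \in cs -> bf E c = - 1 by move/hcs/Pts_bfE.
have hnn c : c \in cs -> nneg c by move/hcs/Pts_nneg.
have scs := has_gram_size hG.
set Y := E *+ s + vec y cs.
have Ynn : nneg Y by apply: nnegD; [exact: nnegMn|exact: nneg_vec].
have YE : bf Y E = (2 * s - sumn y)%N.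
  rewrite bfDl bfMnl bfxx qE (bfC _ _ E) bfE_vec ?sy //; lia.
have bY p w : bf E p = - 1 -> [seq bf c p | c <- cs] = map Posz w ->
    bf Y p = (dot y w)%:Z - s%:Z.
  by move=> hp hw; rewrite bfDl bfMnl hp (bf_vec _ hw); lia.
have in_rows p : bf E p = - 1 -> (forall c, c \in cs -> 0 <= bf c p) ->
    bf Y p < 0 -> [seq absz (bf c p) | c <- cs] \in rows y s.
  move=> hp hc; rewrite (bY _ _ hp (absz_bf hc)) => hlt.
  by apply: rows_complete; rewrite ?size_map ?sy //; lia.
case: (boolP (all (fun p => 0 <= bf Y p) Pts)) => [/allP Yge|/allPn[p hp]].
  have exc p : exceptional p -> - bf Y p <= 6 * (2 * s - sumn y)%N%:Z.
    move=> hp; have [pnn qp _ [pE|pE] hpP] := hp; last first.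
      by have := exceptional_double hp pE Ynn; rewrite YE; lia.
    rewrite leNgt; apply/negP => hlt.
    have hc c : c \in cs -> 0 <= bf c p by rewrite bfC; move/hcs/hpP.
    (* A violation of the bound makes q(Y, p) negative, so the products of p also form a checked
       row. *)
    have := rowsP _ (in_rows p pE hc ltac:(lia)).
    case/andP=> _ /orP[|/hasP[z _]].
      by have := bY _ _ pE (absz_bf hc); lia.
    have hG' := has_gram_border hG (absz_bf hc) qp.
    rewrite (not_neg_at _ _ hG') // => d; rewrite inE => /predU1P[->//|hd].
    by split; [apply: hnn|apply: hE].
  apply: (@bound_of_dominant Y (2 * s - sumn y)%N) => //; try exact: exc.
  - by rewrite bfDr bfMnr bvE bfv_vec // mulr0.
  - by lia.
rewrite -ltNge => Yp.
have pE := Pts_bfE hp; have qp := Pts_qf hp.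
have hc c : c \in cs -> 0 <= bf c p by move/hcs=> ?; apply: Pts_bf.
have hG' := has_gram_border hG (absz_bf hc) qp.
have hcs' : {subset p :: cs <= Pts}.
  by move=> d; rewrite inE => /predU1P[->|/hcs].
have := rowsP _ (in_rows p pE hc Yp).
case/andP=> /orP[/hasP[z _]|/hasP[f _]]; first by rewrite (not_nonpos_at _ hcs' hG').
case/andP=> hf /known_settled h _; apply: h (has_gram_minor hG' hf).
move=> _ /mapP[i fi ->]; apply/hcs'/mem_nth.
by rewrite -(has_gram_size hG'); move/allP: hf; apply.
Qed.

End CertificateSound.

Lemma certificates_settled known cs :
  (forall G, G \in known -> settled G) -> check_all known cs ->
  forall c, c \in map cert_gram cs -> settled c.
Proof.
elim: cs known => [|c cs IH] known hk //= /andP[/(certificate_settled hk) hc hcs].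
move=> G; rewrite inE => /predU1P[->//|]; apply: IH hcs G.
by move=> H; rewrite inE => /predU1P[->|/hk].
Qed.

Lemma E6_settled : settled E6_gram.
Proof.
by apply: (certificates_settled _ E_certificates_valid E6_certified).
Qed.

(** * Configurations of type D *)

(** Type D of rank [size U + 3] with branch node E: [p2] and [p3] are the short arms, and [U]
    consists of the partial sums along the long arm. *)
Definition chain p2 p3 (U : seq 'rV[int]_n) : Prop :=
  [/\ p2 \in Pts, p3 \in Pts, bf p2 p3 = 0 &
   [/\ {subset U <= Pts}, forall u, u \in U -> bf u p2 = 0,
       forall u, u \in U -> bf u p3 = 0
     & pairwise (fun u u' => bf u u' == 1) U]].

Lemma chain_sym p2 p3 U : chain p2 p3 U -> chain p3 p2 U.
Proof. by case=> ? ? ? [? ? ? ?]; split=> //; rewrite bfC. Qed.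

(** A point has product 2 with itself, so [U] has no repetitions. This bounds the induction on
    longer chains. *)
Lemma chain_size p2 p3 U : chain p2 p3 U -> (size U <= size Pts)%N.
Proof.
case=> _ _ _ [hU _ _ pU]; apply: uniq_leq_size => //.
elim: U hU pU => //= u U IH hU /andP[/allP hu pU].
rewrite IH // ?andbT => [|x hx]; last by rewrite hU // inE hx orbT.
by apply/negP => /hu; rewrite bfxx Pts_qf // hU ?mem_head.
Qed.

Lemma chain_sum (U : seq 'rV[int]_n) u : {subset U <= Pts} ->
  pairwise (fun u u' => bf u u' == 1) U -> u \in U ->
  bf (\sum_(x <- U) x) u = (size U).+1.
Proof.
elim: U => //= x U IH hU /andP[/allP hx pU]; rewrite big_cons bfDl.
have hU' : {subset U <= Pts} by move=> y hy; rewrite hU // inE hy orbT.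
rewrite inE => /predU1P[->|hu]; last by rewrite (IH hU' pU hu) (eqP (hx u hu)); lia.
rewrite bfxx Pts_qf ?hU ?mem_head // bf_suml (eq_big_seq (fun=> 1)).
  by rewrite big_const_seq count_predT iter_addr addr0 (natz (size U)); lia.
by move=> y hy; rewrite bfC (eqP (hx y hy)).
Qed.

Lemma chain_sum_sum (U : seq 'rV[int]_n) : {subset U <= Pts} ->
  pairwise (fun u u' => bf u u' == 1) U ->
  bf (\sum_(x <- U) x) (\sum_(x <- U) x) = (size U * (size U).+1)%:Z.
Proof.
move=> hU pU; rewrite [LHS]bf_sumr (eq_big_seq (fun=> (size U).+1%:Z)).
  by rewrite big_const_seq count_predT iter_addr addr0 -mulr_natl natz PoszM.
by move=> u hu; apply: chain_sum.
Qed.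

Lemma bf_sum_E (U : seq 'rV[int]_n) : {subset U <= Pts} ->
  bf E (\sum_(x <- U) x) = - (size U)%:Z.
Proof.
move=> hU; rewrite bf_sumr (eq_big_seq (fun=> - 1)).
  by rewrite big_const_seq count_predT iter_addr addr0 mulNrn (natz (size U)).
by move=> u /hU/Pts_bfE.
Qed.

Lemma bf_sum_eq0 (U : seq 'rV[int]_n) p :
  (forall u, u \in U -> bf u p = 0) -> bf (\sum_(x <- U) x) p = 0.
Proof. by move=> h; rewrite bf_suml big_seq big1. Qed.

Lemma nneg_Psum (U : seq 'rV[int]_n) : {subset U <= Pts} ->
  nneg (\sum_(x <- U) x).
Proof. by move=> hU; apply: nneg_sum => u /hU/Pts_nneg. Qed.

Lemma bf_sum_ge (U : seq 'rV[int]_n) p :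
  (forall u, u \in U -> 0 <= bf u p) ->
  (size U)%:Z - (size [seq u <- U | bf u p == 0])%:Z
  <= bf (\sum_(x <- U) x) p.
Proof.
elim: U => [|u U IH] h; first by rewrite big_nil bf0l.
have hu := h u (mem_head _ _).
have := IH (fun x hx => h x (@mem_behead _ (u :: U) x hx)).
rewrite big_cons bfDl /=; case: eqVneq => hu0 /=; lia.
Qed.

Lemma bf_sum_ge1 (U : seq 'rV[int]_n) p : (forall u, u \in U -> 1 <= bf u p) ->
  (size U)%:Z <= bf (\sum_(x <- U) x) p /\
  (bf (\sum_(x <- U) x) p <= (size U)%:Z -> forall u, u \in U -> bf u p = 1).
Proof.
elim: U => [|x U IH] h; first by rewrite big_nil bf0l.
have hx := h x (mem_head _ _).
have [hge heq] := IH (fun y hy => h y (@mem_behead _ (x :: U) y hy)).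
rewrite big_cons bfDl /=; set S := bf (\sum_(j <- U) j) p in hge heq *.
split=> [|hle u]; first lia.
by rewrite inE => /predU1P[->|/heq ->//]; lia.
Qed.

(* In type D, with simple roots written in the usual orthogonal basis, this is a
   multiple of the fundamental weight of the branch node [E]. *)
Definition chain_vec p2 p3 (U : seq 'rV[int]_n) : 'rV[int]_n :=
  (E *+ 2 + p2 + p3) *+ (size U).+1 + (\sum_(x <- U) x) *+ 2.

Lemma nneg_chain_vec p2 p3 U : chain p2 p3 U -> nneg (chain_vec p2 p3 U).
Proof.
case=> h2 h3 _ [hU _ _ _]; apply: nnegD; apply: nnegMn; last exact: nneg_Psum.
apply: nnegD; [apply: nnegD; first exact: nnegMn|]; exact: Pts_nneg.
Qed.

Lemma chain_vec_E p2 p3 U : chain p2 p3 U -> bf (chain_vec p2 p3 U) E = 2.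
Proof.
case=> h2 h3 _ [hU _ _ _]; rewrite !bfE bfxx qE !(bfC _ _ E).
rewrite (Pts_bfE h2) (Pts_bfE h3) bf_sum_E //; lia.
Qed.

Lemma chain_vec_v p2 p3 U : chain p2 p3 U -> bf v (chain_vec p2 p3 U) = 0.
Proof.
case=> h2 h3 _ [hU _ _ _].
rewrite bfDr !bfMnr 2!(bfDr _ _ _ v) bfMnr bvE (Pts_bfv h2) (Pts_bfv h3).
rewrite bf_sumr big_seq big1 => [|u /hU/Pts_bfv //]; lia.
Qed.

Lemma bf_chain_vec p2 p3 U p : bf (chain_vec p2 p3 U) p =
  (size U).+1%:Z * (2 * bf E p + bf p2 p + bf p3 p)
  + 2 * bf (\sum_(x <- U) x) p.
Proof. by rewrite !bfE; lia. Qed.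

(** The bound 12 is 6 q(Y, E), as required by [bound_of_dominant]. The cases are those of the
    product of p with p2 + p3. *)
Lemma chain_exceptional p2 p3 U p : chain p2 p3 U -> exceptional p ->
  - bf (chain_vec p2 p3 U) p <= 12.
Proof.
move=> hc hp; have [pnn qp _ [pE|pE] pP] := hp; last first.
  have := exceptional_double hp pE (nneg_chain_vec hc).
  by rewrite (chain_vec_E hc); lia.
have [h2 h3 e23 [hU hU2 hU3 pU]] := hc.
rewrite bf_chain_vec pE.
have b2 := pP _ h2; have b3 := pP _ h3; rewrite bfC in b2; rewrite bfC in b3.
have hUp u : u \in U -> 0 <= bf u p by rewrite bfC; move/hU/pP.
have ge0 := bf_sum_ge hUp.
set U0 := [seq u <- U | bf u p == 0] in ge0.
have sU0 : (size U0 <= size U)%N by rewrite size_filter count_size.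
have hU0 u : u \in U0 -> u \in U /\ bf u p = 0.
  by rewrite mem_filter => /andP[/eqP].
have pU0 : pairwise (fun u u' => bf u u' == 1) U0.
  exact: subseq_pairwise (filter_subseq _ _) pU.
have g_nneg : nneg (E *+ 2 + p2 + p3).
  apply: nnegD; [apply: nnegD; first exact: nnegMn|]; exact: Pts_nneg.
have e32 : bf p3 p2 = 0 by rewrite bfC.
have q2 := Pts_qf h2; have q3 := Pts_qf h3.
have E2 := Pts_bfE h2; have E3 := Pts_bfE h3.
have [b0|[b1|bge]] : bf p2 p + bf p3 p = 0 \/ bf p2 p + bf p3 p = 1
    \/ 2 <= bf p2 p + bf p3 p by lia.
- have p20 : bf p2 p = 0 by lia.
  have p30 : bf p3 p = 0 by lia.
  (* For two members u, u' of [U] orthogonal to p, the vector 2E + p2 + p3 + p + u is the isotropic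
     vector of affine D_4, yet its product with u' is -1. *)
  suff : (size U0 <= 1)%N by rewrite p20 p30; nia.
  case: U0 ge0 sU0 hU0 pU0 => [|u [|u' U']] // _ _ hU0 /= /andP[/andP[/eqP uu' _] _].
  have [hu up] := hU0 u (mem_head _ _).
  have [hu' up'] : u' \in U /\ bf u' p = 0 by apply: hU0; rewrite !inE eqxx orbT.
  have qu := Pts_qf (hU _ hu); have uE := Pts_bfE (hU _ hu).
  have u'E := Pts_bfE (hU _ hu').
  have := @isotropic_bf_ge0 (E *+ 2 + p2 + p3 + p + u) u'
    (nnegD (nnegD g_nneg pnn) (Pts_nneg (hU _ hu))) (Pts_nneg (hU _ hu')).
  rewrite !qfE qE q2 q3 qp qu E2 E3 pE e23 p20 p30 uE u'E.
  move: (bfC C p2 u) (bfC C p3 u) (bfC C p u) (bfC C p2 u') (bfC C p3 u').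
  move: (bfC C p u') (hU2 _ hu) (hU3 _ hu) (hU2 _ hu') (hU3 _ hu').
  by move=> *; lia.
- rewrite leNgt; apply/negP => hlt.
  (* Let Y be [chain_vec] for eight members of [U] orthogonal to p. Then q(Y) = 18 and q(Y, p) = -9,
     so q(Y + 4p) = 18 + 16 - 36 = -2. Eight is the least length giving a negative value. *)
  have s12 : (8 <= size U0)%N by nia.
  set W := take 8 U0.
  have hW u : u \in W -> u \in U0 by apply: mem_take.
  have sW : size W = 8%N by rewrite size_takel.
  have hWP : {subset W <= Pts} by move=> u /hW/hU0[/hU].
  have pW : pairwise (fun u u' => bf u u' == 1) W.
    exact: subseq_pairwise (take_subseq _ _) pU0.
  have := chain_sum_sum hWP pW; have := bf_sum_E hWP.
  have : bf (\sum_(x <- W) x) p2 = 0 by apply: bf_sum_eq0 => u /hW/hU0[/hU2].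
  have : bf (\sum_(x <- W) x) p3 = 0 by apply: bf_sum_eq0 => u /hW/hU0[/hU3].
  have : bf (\sum_(x <- W) x) p = 0 by apply: bf_sum_eq0 => u /hW/hU0[].
  have := nneg_Psum hWP; rewrite sW bfxx.
  move: (\sum_(x <- W) x) => S Snn Sp S3 S2 ES qS.
  have := qf_ge0 (nnegD (nnegD (nnegMn 4 pnn) (nnegMn 9 g_nneg)) (nnegMn 2 Snn)).
  rewrite !qfE qE q2 q3 qp E2 E3 e23 ES; move: (bfC C p S) (bfC C p2 S) (bfC C p3 S).
  by move: (bfC C p E) (bfC C p p2) (bfC C p p3); lia.
- by nia.
Qed.

Lemma has_gram_nil : has_gram C [::] [::]. Proof. by []. Qed.

Lemma settled_triangular (G : seq (seq nat)) u1 u2 u3 u4 u5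
    (w12 w13 w14 w15 w23 w24 w25 w34 w35 w45 : nat) :
  settled G ->
  G = [:: [:: 2; w12; w13; w14; w15]; [:: w12; 2; w23; w24; w25];
          [:: w13; w23; 2; w34; w35]; [:: w14; w24; w34; 2; w45];
          [:: w15; w25; w35; w45; 2]]%N ->
  {subset [:: u1; u2; u3; u4; u5] <= Pts} ->
  bf u2 u1 = w12 -> bf u3 u1 = w13 -> bf u4 u1 = w14 -> bf u5 u1 = w15 ->
  bf u3 u2 = w23 -> bf u4 u2 = w24 -> bf u5 u2 = w25 ->
  bf u4 u3 = w34 -> bf u5 u3 = w35 -> bf u5 u4 = w45 -> (M <= 12)%N.
Proof.
move=> hG defG hu e12 e13 e14 e15 e23 e24 e25 e34 e35 e45; apply: (hG _ hu).
have q u : u \in [:: u1; u2; u3; u4; u5] -> qf u = 1 by move/hu/Pts_qf.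
have h5 := @has_gram_border _ _ _ _ u5 [::] has_gram_nil erefl
  (q u5 ltac:(by rewrite !inE eqxx ?orbT)).
have h4 := @has_gram_border _ _ _ _ u4 [:: w45] h5
  ltac:(by rewrite /= e45) (q u4 ltac:(by rewrite !inE eqxx ?orbT)).
have h3 := @has_gram_border _ _ _ _ u3 [:: w34; w35] h4
  ltac:(by rewrite /= e34 e35) (q u3 ltac:(by rewrite !inE eqxx ?orbT)).
have h2 := @has_gram_border _ _ _ _ u2 [:: w23; w24; w25] h3
  ltac:(by rewrite /= e23 e24 e25) (q u2 ltac:(by rewrite !inE eqxx ?orbT)).
have h1 := @has_gram_border _ _ _ _ u1 [:: w12; w13; w14; w15] h2
  ltac:(by rewrite /= e12 e13 e14 e15) (q u1 ltac:(by rewrite !inE eqxx ?orbT)).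
by rewrite defG.
Qed.

(** The point p lengthens the arm of p2. The inequality on the sum over [U] expresses q(Y, p) < 0
    for Y the [chain_vec]; the outcome depends on how many members of [U] are orthogonal to p. *)
Lemma chain_branch p2 p3 U p : chain p2 p3 U -> (0 < size U)%N -> p \in Pts ->
  bf p2 p = 1 -> bf p3 p = 0 -> 2 * bf (\sum_(x <- U) x) p <= (size U)%:Z ->
  (forall q2 q3 U', chain q2 q3 U' -> (size U < size U')%N -> (M <= 12)%N) ->
  (M <= 12)%N.
Proof.
move=> hc U_gt0 hp b2 b3 hle IH; have [h2 h3 e23 [hU hU2 hU3 pU]] := hc.
have hUp u : u \in U -> 0 <= bf u p by move/hU=> hu; apply: Pts_bf.
have := bf_sum_ge hUp; set U0 := [seq u <- U | bf u p == 0] => ge0.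
have sU0 : (size U0 <= size U)%N by rewrite size_filter count_size.
have hU0 u : u \in U0 -> u \in U /\ bf u p = 0.
  by rewrite mem_filter => /andP[/eqP].
have pU0 : pairwise (fun u u' => bf u u' == 1) U0.
  exact: subseq_pairwise (filter_subseq _ _) pU.
(* Two such members give arms u1, u2 and p2, p and p3, that is, type E_6. With at most one, the sum
   over [U] is at least [size U - 1], so [size U] is at most 2. *)
have [two|] := leqP 2 (size U0).
  case: U0 two hU0 pU0 {ge0 sU0} => [|u1 [|u2 U']] // _ hU0.
  move=> /= /andP[/andP[/eqP e12 _] _].
  have [hu1 u1p] := hU0 u1 (mem_head _ _).
  have [hu2 u2p] : u2 \in U /\ bf u2 p = 0 by apply: hU0; rewrite !inE eqxx orbT.
  apply: (@settled_triangular _ u1 u2 p2 p p3 1 0 0 0 0 0 0 1 0 0 E6_settled) => //.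
  - by move=> x; rewrite !inE => /or4P[||/eqP->//|/orP[]] /eqP->//; exact: hU.
  - by rewrite bfC.
  - by rewrite bfC hU2.
  - by rewrite bfC.
  - by rewrite bfC hU3.
  - by rewrite bfC hU2.
  - by rewrite bfC.
  - by rewrite bfC hU3.
  - by rewrite bfC.
  - by rewrite bfC.
have defU0 : U0 = [seq u <- U | bf u p == 0] by [].
case: U hc U_gt0 hle IH hU hU2 hU3 pU hUp U0 defU0 ge0 sU0 hU0 pU0
  => [|u1 [|u2 [|u3 U]]] // hc _ hle IH hU hU2 hU3 pU hUp
     U0 defU0 ge0 sU0 hU0 pU0 small.
- have u1p : bf u1 p = 0.
    by move: hle (hUp u1 (mem_head _ _)); rewrite big_seq1 /=; lia.
  (* The roles of the arms are exchanged: p2, p become the long arm and u1 a short one. *)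
  apply: (IH u1 p3 [:: p2; p]) => //; split=> //; try exact/hU/mem_head.
    exact/hU3/mem_head.
  split.
  + by move=> x; rewrite !inE => /orP[] /eqP->.
  + by move=> x; rewrite !inE => /orP[] /eqP->; rewrite bfC // hU2 ?mem_head.
  + by move=> x; rewrite !inE => /orP[] /eqP->; rewrite // bfC.
  + by rewrite /= b2 eqxx.
- have i1 : u1 \in [:: u1; u2] by rewrite mem_head.
  have i2 : u2 \in [:: u1; u2] by rewrite !inE eqxx orbT.
  move: pU; rewrite /= !andbT => /eqP e12.
  (* The certificates may fall back on [chain3_gram], which is a chain of length 3 > 2 and is
     covered by [IH]. *)
  have N_settled : settled N_gram.
    apply: (certificates_settled _ N_certificates_valid N_certified) => G.
    rewrite inE => /predU1P[->|hG]; last first.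
      exact: (certificates_settled _ E_certificates_valid hG).
    case=> [|q2 [|q3 [|v1 [|v2 [|v3 [|? ?]]]]]] // hq hG.
    have hin k : (k < 5)%N -> nth 0 [:: q2; q3; v1; v2; v3] k \in Pts.
      by move=> hk; apply/hq/mem_nth.
    have hgr i j : (i < 5)%N -> (j < 5)%N ->
        bf (nth 0 [:: q2; q3; v1; v2; v3] i) (nth 0 [:: q2; q3; v1; v2; v3] j)
        = nth 0%N (nth [::] chain3_gram i) j.
      move=> hi hj; have := congr1 (fun s => nth 0 (nth [::] s i) j) hG.
      rewrite /cross (nth_map 0) // (nth_map 0) // => ->.
      by case: i hi => [|[|[|[|[|?]]]]] //; case: j hj => [|[|[|[|[|?]]]]].
    apply: (IH q2 q3 [:: v1; v2; v3]) => //; split.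
    + exact: (hin 0%N).
    + exact: (hin 1%N).
    + exact: (hgr 0%N 1%N).
    + split.
      * by move=> x hx; apply: hq; rewrite !inE in hx *; rewrite hx !orbT.
      * move=> x; rewrite !inE => /or3P[] /eqP->;
          [exact: (hgr 2 0)%N|exact: (hgr 3 0)%N|exact: (hgr 4 0)%N].
      * move=> x; rewrite !inE => /or3P[] /eqP->;
          [exact: (hgr 2 1)%N|exact: (hgr 3 1)%N|exact: (hgr 4 1)%N].
      * by rewrite /= (hgr 2 3)%N // (hgr 2 4)%N // (hgr 3 4)%N.
  have nconf x y : x \in [:: u1; u2] -> y \in [:: u1; u2] -> bf y x = 1 ->
      bf x p = 0 -> bf y p = 1 -> (M <= 12)%N.
    move=> hx hy xy xp yp.
    apply: (@settled_triangular _ x y p2 p p3 1 0 0 0 0 1 0 1 0 0 N_settled) => //.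
    + by move=> z; rewrite !inE => /or4P[||/eqP->//|/orP[]] /eqP->//; exact: hU.
    + by rewrite bfC hU2.
    + by rewrite bfC.
    + by rewrite bfC hU3.
    + by rewrite bfC hU2.
    + by rewrite bfC.
    + by rewrite bfC hU3.
    + by rewrite bfC.
    + by rewrite bfC.
  (* Exactly one of u1, u2 is orthogonal to p and the other has product 1 with it, which is the
     configuration N. *)
  have := hUp _ i1; have := hUp _ i2.
  move: hle small; rewrite defU0 big_cons big_seq1 bfDl /=.
  case: (eqVneq (bf u1 p) 0) => z1; case: (eqVneq (bf u2 p) 0) => z2 //= *.
  + by apply: (nconf u1 u2) => //; [rewrite bfC|lia].
  + by apply: (nconf u2 u1) => //; lia.
  + lia.
- by move: hle ge0; rewrite /= in small *; lia.
Qed.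

(** Induction on the number of points outside [U]. A point with negative product with Y either
    prolongs the long arm or branches at one of the short arms. *)
Lemma chain_bound p2 p3 U : chain p2 p3 U -> (0 < size U)%N -> (M <= 12)%N.
Proof.
have [k] := ubnP (size Pts - size U)%N.
elim: k p2 p3 U => // k IHk p2 p3 U hk hc U_gt0.
have IH q2 q3 U' : chain q2 q3 U' -> (size U < size U')%N -> (M <= 12)%N.
  move=> hc' lt; have := chain_size hc'.
  by move=> ?; apply: (IHk q2 q3 U') => //; lia.
have [h2 h3 e23 [hU hU2 hU3 pU]] := hc.
case: (boolP (all (fun p => 0 <= bf (chain_vec p2 p3 U) p) Pts)) => [/allP Yge|].
  apply: (bound_of_dominant (chain_vec_v hc) _ (chain_vec_E hc)) => //;
    exact: chain_exceptional.
case/allPn=> p hp; rewrite -ltNge bf_chain_vec (Pts_bfE hp) => Yp.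
have b2 := Pts_bf h2 hp; have b3 := Pts_bf h3 hp.
have hUp u : u \in U -> 0 <= bf u p by move/hU=> hu; apply: Pts_bf.
have S0 : 0 <= bf (\sum_(x <- U) x) p.
  by rewrite bf_suml big_seq; apply: sumr_ge0.
have [bs|[bs|bs]] : bf p2 p + bf p3 p = 0 \/ bf p2 p + bf p3 p = 1
    \/ 2 <= bf p2 p + bf p3 p by lia.
- have p20 : bf p2 p = 0 by lia.
  have p30 : bf p3 p = 0 by lia.
  (* If q(u, p) = 0, then 2E + p2 + p3 + u + p is isotropic of type affine D_4 and orthogonal to
     [v], which is excluded. *)
  have up1 u : u \in U -> 1 <= bf u p.
    move=> hu; have uP := hU _ hu.
    have xnn : nneg (p2 + p3 + u + p).
      by apply: nnegD; [apply: nnegD; [apply: nnegD|]|]; apply: Pts_nneg.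
    have bvx : bf v (p2 + p3 + u + p) = 0.
      by rewrite !(bfDr _ _ _ v) !Pts_bfv.
    have := @center_qf_gt0 2 _ isT xnn bvx.
    rewrite !qfE qE !Pts_qf // !Pts_bfE // e23 p20 p30.
    move: (bfC C p2 u) (bfC C p3 u) (hU2 _ hu) (hU3 _ hu) (hUp _ hu).
    by move=> *; lia.
  (* Since q(Y, p) < 0 bounds the sum over [U] by [size U], all these products equal 1 and p can be
     added to [U]. *)
  have [_ /(_ ltac:(lia)) eq1] := bf_sum_ge1 up1.
  apply: (IH p2 p3 (p :: U)) => //; split=> //; split.
  + by move=> x; rewrite inE => /predU1P[->|/hU].
  + by move=> x; rewrite inE => /predU1P[->|/hU2//]; rewrite bfC.
  + by move=> x; rewrite inE => /predU1P[->|/hU3//]; rewrite bfC.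
  + by rewrite /= pU andbT; apply/allP => u /eq1; rewrite bfC => ->.
- have [[c2 c3]|[c2 c3]] : bf p2 p = 1 /\ bf p3 p = 0 \/ bf p3 p = 1 /\ bf p2 p = 0
    by lia.
  + by apply: (chain_branch hc U_gt0 hp c2 c3 _ IH); lia.
  + by apply: (chain_branch (chain_sym hc) U_gt0 hp c2 c3 _ IH); lia.
- by nia.
Qed.

(** * Three pairwise orthogonal points *)

Lemma size_Pts : (size Pts)%:Z = 2 * M%:Z + bf a E + bf b E.
Proof.
move: bvE; rewrite !bfDl bfMnl bfxx qE (bfC _ (\sum_(p <- _) p)) bf_sum_E //; lia.
Qed.

Lemma sum_bf_Pts p : p \in Pts ->
  bf (\sum_(x <- Pts) x) p = M%:Z - bf a p - bf b p.
Proof. by move=> hp; move: (Pts_bfv hp); rewrite !bfDl bfMnl (Pts_bfE hp); lia. Qed.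

Lemma exceptional_bfE p : exceptional p -> -2 <= bf p E <= -1.
Proof. by rewrite (bfC C p E); case=> _ _ _ [] -> _. Qed.

(** The case q(E, p) = -2 is the substantial one: the isotropic vector E + p then forces q(p, x) >=
    1. *)
Lemma exceptional_ge p x : exceptional p -> x \in Pts -> - bf p E - 1 <= bf p x.
Proof.
move=> hp hx; have [_ _ _ [pE|pE] hpP] := hp; rewrite (bfC C p E) pE.
  exact: hpP.
have := exceptional_double hp pE (Pts_nneg hx).
by rewrite (bfC C x p) (bfC C x E) Pts_bfE //; lia.
Qed.

(** Otherwise all products with p are at least 1, so the number 2M + q(a, E) + q(b, E) of points is
    at most M - q(a, p) - q(b, p), which makes M at most 2. *)
Lemma orthogonal_partner p : (4 < M)%N -> p \in Pts ->
  exists2 p', p' \in Pts & bf p' p = 0.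
Proof.
move=> M4 hp; case: (boolP (has (fun x => bf x p == 0) Pts)) => [/hasP[x hx /eqP]|].
  by exists x.
move/hasPn=> h; have [] := @bf_sum_ge1 Pts p.
  by move=> x hx; have := h x hx; have := Pts_bf hx hp; lia.
rewrite sum_bf_Pts // size_Pts => hle _.
have := exceptional_bfE a_exceptional; have := exceptional_bfE b_exceptional.
have := exceptional_ge a_exceptional hp; have := exceptional_ge b_exceptional hp.
lia.
Qed.

Lemma orthogonal_triple : (4 < M)%N -> exists p1 p2 p3,
  [/\ p1 \in Pts, p2 \in Pts, p3 \in Pts
    & [/\ bf p2 p3 = 0, bf p1 p2 = 0 & bf p1 p3 = 0]].
Proof.
move=> M4; have eaE := exceptional_bfE a_exceptional.
have ebE := exceptional_bfE b_exceptional.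
case: (boolP (has (fun p3 => has (fun p2 => (bf p2 p3 == 0) &&
    has (fun p1 => (bf p1 p2 == 0) && (bf p1 p3 == 0)) Pts) Pts) Pts)).
  case/hasP=> p3 h3 /hasP[p2 h2 /andP[/eqP e23 /hasP[p1 h1 /andP[/eqP e12 /eqP e13]]]].
  by exists p1, p2, p3.
move/hasPn=> none.
have aP p : p \in Pts -> bf a p = 0 /\ bf a E = -1 /\ bf b p = 0 /\ bf b E = -1.
  move=> hp; have [p' hp' pp'] := orthogonal_partner M4 hp.
  have := none p hp => /hasPn /(_ p' hp'); rewrite pp' eqxx /= => /hasPn tri.
  (* Without a triple every point contributes at least 0 to this sum, and p and p' contribute 1
     each. Evaluating it through q(v, p) = q(v, p') = q(v, E) = 0 shows that it is at most 2, and
     equality forces the claim. *)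
  have : 2 <= \sum_(x <- Pts) (bf x p + bf x p' - 1).
    have pp : p' != p.
      by apply/eqP => e; move: pp'; rewrite e bfxx Pts_qf.
    rewrite (big_rem p) //= (big_rem p') /=; last first.
      rewrite (perm_mem (perm_to_rem hp)) inE in hp'.
      by case/predU1P: hp' => // e; rewrite e eqxx in pp.
    rewrite !bfxx !Pts_qf // (bfC C p p') pp'.
    have : 0 <= \sum_(y <- rem p' (rem p Pts)) (bf y p + bf y p' - 1).
      rewrite big_seq; apply: sumr_ge0 => y /mem_rem/mem_rem hy.
      by have := tri y hy; have := Pts_bf hy hp; have := Pts_bf hy hp'; lia.
    by set S := \sum_(y <- _) _; lia.
  rewrite !big_split /= -!bf_suml sum_bf_Pts // sum_bf_Pts //.
  rewrite big_const_seq count_predT iter_addr addr0 mulNrn (natz (size Pts)) size_Pts.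
  have := exceptional_ge a_exceptional hp; have := exceptional_ge b_exceptional hp.
  have := exceptional_ge a_exceptional hp'; have := exceptional_ge b_exceptional hp'.
  by move=> *; lia.
have [p hp] : exists p, p \in Pts.
  case: Pts size_Pts => [|p ? _]; first by rewrite /=; lia.
  by exists p; rewrite mem_head.
have [_ [aE [_ bE]]] := aP p hp.
have [ann qa bva _ _] := a_exceptional; have [bnn qb bvb _ _] := b_exceptional.
have S0 : bf (\sum_(x <- Pts) x) a = 0.
  by apply: bf_sum_eq0 => x /aP[]; rewrite bfC.
have bab : bf b a = M%:Z - 1.
  by move: bva; rewrite !bfDl bfMnl S0 bfxx qa (bfC C E a) aE; lia.
have Snn : nneg (\sum_(x <- Pts) x) by apply: nneg_Psum.
have qv : qf v = 1.
  have := bfxx C v; rewrite {1}bfDr {1}bfDr {1}bfDr bfMnr bvE bva bvb bf_sumr.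
  by rewrite big_seq big1 => [|x /Pts_bfv //]; lia.
(* This vector is M E + 2a plus the sum of the points, but its value is 3 - q(a, b) + q(v, a) - q(v,
   b) = 4 - M < 0. *)
have hnn : nneg (v + a - b).
  have -> : v + a - b = E *+ M + a + \sum_(x <- Pts) x + a.
    by rewrite [E *+ M + a + b]addrAC -!addrA; congr (_ + _); rewrite addrCA
      [b + _]addrC -!addrA addNr addr0 addrCA.
  by do 3!apply: nnegD => //; apply: nnegMn.
have := qf_ge0 hnn; rewrite qfD qfN (qfD _ v a) qv qa qb bfNr (bfDl _ v a).
by rewrite bva bvb (bfC C a b) bab; lia.
Qed.

Theorem star_bound : (M <= 12)%N.
Proof.
rewrite leqNgt; apply/negP => M13.
have [p1 [p2 [p3 [h1 h2 h3 [e23 e12 e13]]]]] := orthogonal_triple ltac:(lia).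
suff : (M <= 12)%N by lia.
(* The three points form a chain of type D_4. *)
apply: (@chain_bound p2 p3 [:: p1]) => //; split=> //; split=> //.
all: by move=> x; rewrite inE => /eqP->.
Qed.

End Star.

(** * Reduction to a star-shaped decomposition *)

Section RootBound.
Variables (n : nat) (C : 'M[int]_n) (v : 'rV[int]_n).
Notation bf := (bf C).
Notation qf := (qf C).
Notation unitv i := (delta_mx 0 i : 'rV[int]_n).
Hypothesis C1 : forall i, C i i = 1.
Hypothesis Cslender : forall i j, i != j -> -1 <= C i j + C j i.
Hypothesis v_gt0 : forall i, 0 < v 0 i.
Hypothesis qv : qf v = 1.
Hypothesis v_max :
  forall w, nneg w -> qf w = 1 -> (forall i, v 0 i <= w 0 i) -> w = v.

Let qge0 x : nneg x -> 0 <= qf x.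
Proof. exact: qf_ge0 v_max x. Qed.
Let bv_ge0 x : nneg x -> 0 <= bf v x.
Proof. exact: bf_v_ge0 v_max x. Qed.
Let aniso x : nneg x -> qf x = 0 -> bf v x = 0 -> x = 0.
Proof. exact: isotropic_eq0 v_max x. Qed.

Variable w : 'I_n.

Definition part (x : 'rV[int]_n) : Prop :=
  [/\ nneg x, x != 0, x 0 w = 0 & qf x <= 1].

Lemma partD x y : part x -> part y -> qf (x + y) <= 1 -> part (x + y).
Proof.
case=> hx x0 xw _ [hy _ yw _] hq; split=> //; first exact: nnegD.
  have [i hi] := nneg_neq0 hx x0; apply/eqP => /rowP/(_ i); rewrite !mxE => /eqP.
  by rewrite gt_eqF // ltr_wpDr.
by rewrite mxE xw yw.
Qed.

Lemma part_sum_exists x : nneg x -> x 0 w = 0 ->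
  exists2 ps : seq 'rV[int]_n, (forall y, y \in ps -> part y) & x = \sum_(y <- ps) y.
Proof.
have [k] := ubnP (absz (\sum_j x 0 j)).
elim: k x => // k IH x hk hx xw.
have [->|x0] := eqVneq x 0; first by exists [::]; rewrite // big_nil.
have [i hi] := nneg_neq0 hx x0; have S0 := sum_coord_gt0 hx x0.
have iw : i != w by apply: contraTneq hi => ->; rewrite xw.
have [||ps hps e] := IH (x - unitv i) _ (nneg_subunit hx hi).
- by rewrite sum_coordB; lia.
- by rewrite !mxE eqxx (negPf (_ : w != i)) 1?eq_sym //= subr0.
exists (unitv i :: ps); last by rewrite big_cons -e addrC subrK.
move=> y; rewrite inE => /predU1P[->|/hps //]; split.
- exact: nneg_unitv.
- by apply/eqP => /rowP/(_ i); rewrite !mxE !eqxx.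
- by rewrite mxE eqxx (negPf (_ : w != i)) 1?eq_sym.
- by rewrite qf_unitv.
Qed.

(** Two summands whose sum is still a part are merged; this lowers their number, so the process
    stops. *)
Lemma part_sum_reduced x : nneg x -> x 0 w = 0 ->
  exists ps : seq 'rV[int]_n, [/\ forall y, y \in ps -> part y, x = \sum_(y <- ps) y
    & forall y z, y \in ps -> z \in rem y ps -> 1 < qf (y + z)].
Proof.
move=> hx xw; have [ps] := part_sum_exists hx xw.
have [k] := ubnP (size ps); elim: k ps => // k IH ps hk hps e.
case: (boolP (all (fun y => all (fun z => 1 < qf (y + z)) (rem y ps)) ps)).
  by move=> /allP h; exists ps; split=> // y z /h/allP; apply.
case/allPn=> y hy /allPn[z hz]; rewrite -leNgt => hyz.
apply: (IH (y + z :: rem z (rem y ps))).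
- have : (0 < size (rem y ps))%N by case: (rem y ps) hz.
  rewrite /= (size_rem hz) (size_rem hy); move: (size ps) hk => m.
  by case: m => [|[|m]].
- move=> u; rewrite inE => /predU1P[->|/mem_rem/mem_rem/hps //].
  by apply: partD => //; apply: hps => //; apply: mem_rem hz.
- by rewrite e (big_rem y) //= (big_rem z) //= big_cons addrA.
Qed.

Theorem root_bound : v 0 w <= 12.
Proof.
rewrite leNgt; apply/negP => w13.
set E := unitv w; set M := absz (v 0 w).
have vw : v 0 w = M by rewrite gez0_abs //; exact: ltW.
have Enn : nneg E by exact: nneg_unitv.
have qE : qf E = 1 by exact: qf_unitv.
have vnn : nneg v by exact: nneg_v.
have restnn : nneg (v - E *+ M).
  move=> i; rewrite !mxE mulmxnE mxE eqxx /=; have := v_gt0 i.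
  by case: (eqVneq i w) => [->|_] /=; rewrite ?mul0rn ?(natz M); lia.
have restw : (v - E *+ M) 0 w = 0.
  by rewrite !mxE mulmxnE mxE !eqxx /= vw (natz M) subrr.
have [ps [psP hv ps_rem]] := part_sum_reduced restnn restw.
have {}hv : v = E *+ M + \sum_(x <- ps) x by rewrite -hv addrC subrK.
have psnn x : x \in ps -> nneg x by case/psP.
have bvps x : x \in ps -> 0 <= bf v x by move/psnn/bv_ge0.
have sum2 : M%:Z * bf v E + \sum_(x <- ps) bf v x = 2.
  by have := bfxx C v; rewrite {2}hv bfDr bfMnr bf_sumr qv.
have S0 : 0 <= \sum_(x <- ps) bf v x by rewrite big_seq; apply: sumr_ge0.
(* Both terms of [sum2] are nonnegative, and M > 2. *)
have bvE : bf v E = 0 by have := bv_ge0 Enn; nia.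
have {}sum2 : \sum_(x <- ps) bf v x = 2 by rewrite -sum2 bvE mulr0 add0r.
have bE_nn x : nneg x -> qf x = 0 -> 0 <= bf E x.
  by move=> hx qx; rewrite bfC; apply: (isotropic_bf_ge0 qge0).
have remS x : x \in ps -> \sum_(y <- ps) y = x + \sum_(y <- rem x ps) y.
  by move=> hx; rewrite (big_rem x).
(* An isotropic summand x has q(v, x) = 1, and every other summand has product at least 1 with it,
   so there are at most two summands. Then q(v, E) >= 2M - 4 > 0. *)
have qps x : x \in ps -> qf x = 1.
  move=> hx; have [xnn x0 xw xq] := psP _ hx; apply/eqP; rewrite -[_ == _]negbK.
  apply/negP => q1; have qx : qf x = 0 by have := qge0 xnn; lia.
  have bvx : 0 < bf v x.
    rewrite lt_def bv_ge0 // andbT; apply: contra_neq x0 => b0; exact: aniso.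
  have vxnn : nneg (v - x).
    rewrite hv (remS x hx) addrCA addrAC subrr add0r.
    apply: nnegD; first exact: nnegMn.
    by apply: nneg_sum => y /mem_rem/psnn.
  have bv1 : bf v x = 1.
    by have := qge0 vxnn; rewrite !qfE qv qx; lia.
  have brem y : y \in rem x ps -> 1 <= bf y x.
    move=> hy; have := ps_rem x y hx hy; have [_ _ _ qy] := psP _ (mem_rem hy).
    by rewrite qfD qx bfC; lia.
  have bEx := bE_nn x xnn qx.
  have srem : (size (rem x ps) <= 1)%N.
    have : (size (rem x ps))%:Z <= bf (\sum_(y <- rem x ps) y) x.
      rewrite bf_suml; apply: (@le_trans _ _ (\sum_(y <- rem x ps) 1)).
        by rewrite big_const_seq count_predT iter_addr addr0 (natz (size _)).
      by rewrite big_seq [leRHS]big_seq; apply: ler_sum.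
    by move: bv1; rewrite {1}hv (remS x hx) !bfDl bfMnl bfxx qx; nia.
  have bEge y : y \in ps -> - 2 <= bf E y.
    move=> hy; have [ynn _ _ qy] := psP _ hy.
    by have := qge0 (nnegD Enn ynn); rewrite qfD qE; lia.
  have sps : (size ps <= 2)%N.
    by move: srem; rewrite size_rem //; case: (size ps) => [|[|[|m]]].
  have : (size ps)%:Z * - 2 <= bf E (\sum_(y <- ps) y).
    rewrite bf_sumr; apply: (@le_trans _ _ (\sum_(y <- ps) - 2)).
      by rewrite big_const_seq count_predT iter_addr addr0
        -[(size ps)%:Z]natz mulr_natl.
    by rewrite big_seq [leRHS]big_seq; apply: ler_sum.
  by move: bvE; rewrite bfC {1}hv bfDr bfMnr bfxx qE; lia.
have bps x y : x \in ps -> y \in ps -> 0 <= bf x y.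
  move=> hx hy; have [->|xy] := eqVneq x y; first by rewrite bfxx qps.
  have hyr : y \in rem x ps.
    by move: hy; rewrite (perm_mem (perm_to_rem hx)) inE eq_sym (negPf xy).
  by have := ps_rem x y hx hyr; rewrite qfD !qps //; lia.
have bv_le1 x : x \in ps -> bf v x <= 1.
  move=> hx; have [xnn x0 xw _] := psP _ hx; rewrite leNgt; apply/negP => b2.
  have bx2 : bf v x = 2.
    move: sum2; rewrite (big_rem x) //=.
    have : 0 <= \sum_(y <- rem x ps) bf v y.
      by rewrite big_seq; apply: sumr_ge0 => y /mem_rem/bvps.
    by set S := \sum_(y <- _) _; lia.
  have vxnn : nneg (v - x).
    rewrite hv (remS x hx) addrCA addrAC subrr add0r.
    apply: nnegD; first exact: nnegMn.
    by apply: nneg_sum => y /mem_rem/psnn.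
  (* If q(v, x) = 2, then v - x is isotropic and orthogonal to v, so v = x; but x vanishes at
     [w]. *)
  have /rowP/(_ w) : v - x = 0.
    apply: aniso => //; first by rewrite !qfE qv qps // bx2.
    by rewrite bfDr bfNr bfxx qv bx2.
  by rewrite !mxE xw subr0 => v0; rewrite v0 in w13.
have bE_lt0 x : x \in ps -> bf E x <= - 1.
  move=> hx; have := bv_le1 x hx; rewrite {1}hv (remS x hx) !bfDl bfMnl bfxx qps //.
  have : 0 <= bf (\sum_(y <- rem x ps) y) x.
    by rewrite bf_suml big_seq; apply: sumr_ge0 => y /mem_rem hy; exact: bps.
  by nia.
have bE_ge x : x \in ps -> - 2 <= bf E x.
  by move=> hx; have := qge0 (nnegD Enn (psnn x hx)); rewrite qfD qE qps //; lia.
have pos_exists (s : seq 'rV[int]_n) : 0 < \sum_(x <- s) bf v x ->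
    exists2 x, x \in s & 0 < bf v x.
  elim: s => [|x s IH]; first by rewrite big_nil.
  rewrite big_cons; set S := \sum_(y <- s) _ in IH *.
  case: (ltP 0 (bf v x)) => [hx _|hx h].
    by exists x; rewrite ?mem_head.
  by have [|y hy ?] := IH; [lia|exists y; rewrite // inE hy orbT].
(* The products q(v, x) are 0 or 1 with sum 2, so exactly two summands are exceptional. *)
have [a ha a_gt0] := pos_exists ps ltac:(by rewrite sum2).
have bva : bf v a = 1 by have := bv_le1 a ha; lia.
have sum1 : \sum_(x <- rem a ps) bf v x = 1.
  by move: sum2; rewrite (big_rem a) //= bva; set S := \sum_(y <- _) _; lia.
have [b hb b_gt0] := pos_exists (rem a ps) ltac:(by rewrite sum1).
have hb' := mem_rem hb.
have bvb : bf v b = 1 by have := bv_le1 b hb'; lia.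
set Pts := rem b (rem a ps).
have Pps p : p \in Pts -> p \in ps by move/mem_rem/mem_rem.
have Pv p : p \in Pts -> bf v p = 0.
  move=> hp; have := sum1; rewrite (big_rem b) //= bvb (big_rem p) //=.
  have : 0 <= \sum_(y <- rem p Pts) bf v y.
    by rewrite big_seq; apply: sumr_ge0 => y /mem_rem/Pps/bvps.
  by have := bvps p (Pps p hp); set S := \sum_(y <- _) _; lia.
have hvs : E *+ M + a + b + \sum_(p <- Pts) p = v.
  rewrite [RHS]hv (remS a ha) [in RHS](big_rem b) //=.
  by rewrite -!addrA.
have exc x : x \in ps -> bf v x = 1 -> exceptional C M E a b Pts x.
  move=> hx bvx; split; rewrite ?hvs ?qps //; first exact: psnn.
    by have := bE_lt0 x hx; have := bE_ge x hx; lia.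
  by move=> p /Pps; apply: bps.
suff : (M <= 12)%N by rewrite vw in w13; lia.
apply: (@star_bound n C qge0 M E a b Pts); rewrite ?hvs //; try exact: exc.
move=> p hp; have hps := Pps p hp; split; rewrite ?hvs ?qps ?Pv //.
- exact: psnn.
(* The value -2 would make E + p isotropic and orthogonal to v, hence zero. *)
- have [//|e2] : bf E p = -1 \/ bf E p = -2.
    by have := bE_lt0 p hps; have := bE_ge p hps; lia.
  have /rowP/(_ w) : E + p = 0.
    apply: aniso; first exact: nnegD (psnn p hps).
      by rewrite qfD qE qps // e2.
    by rewrite bfDr bvE Pv.
  by have [_ _ pw _] := psP p hps; rewrite !mxE pw !eqxx.
- by move=> p' /Pps; apply: bps.
Qed.

End RootBound.

(** * The Tits form *)

Section TitsForm.
Variables (n m : nat) (src tgt : 'I_m -> 'I_n).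

(** Arrows and relations are recorded with their orientation; the polar form symmetrizes the
    matrix. *)
Definition tits_mx (r : 'I_n -> 'I_n -> nat) : 'M[int]_n :=
  \matrix_(i, j) ((i == j)%:Z
    - \sum_(a < m) ((src a == i) && (tgt a == j))%:Z + (r i j)%:Z).

Lemma tits_formE r v : tits_form src tgt r v = qf (tits_mx r) (\row_i v i).
Proof.
have qfE' C x : @qf n C x = \sum_i \sum_j x 0 i * C i j * x 0 j.
  rewrite /qf !mxE exchange_big /=; apply: eq_bigr => j _.
  by rewrite !mxE big_distrl.
rewrite qfE' /tits_form.
have -> : \sum_(i < n) v i ^+ 2 = \sum_i \sum_j v i * (i == j)%:Z * v j.
  apply: eq_bigr => i _; rewrite (bigD1 i) //= eqxx mulr1 big1 ?addr0 // => j ji.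
  by rewrite eq_sym (negPf ji) mulr0 mul0r.
have -> : \sum_(a < m) v (src a) * v (tgt a) =
    \sum_i \sum_j v i * (\sum_(a < m) ((src a == i) && (tgt a == j))%:Z) * v j.
  under [RHS]eq_bigr => i _ do under eq_bigr => j _ do rewrite mulr_sumr mulr_suml.
  under [RHS]eq_bigr => i _ do rewrite exchange_big.
  rewrite exchange_big; apply: eq_bigr => a _.
  rewrite (bigD1 (src a)) //= (bigD1 (tgt a)) //= !eqxx mulr1.
  rewrite big1 => [|j ja]; last by rewrite eq_sym (negPf ja) mulr0 mul0r.
  rewrite addr0 big1 ?addr0 // => i ia; rewrite big1 // => j _.
  by rewrite eq_sym (negPf ia) mulr0 mul0r.
rewrite -sumrB -big_split; apply: eq_bigr => i _ /=.
rewrite -sumrB -big_split; apply: eq_bigr => j _ /=.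
by rewrite !mxE; ring.
Qed.

Lemma row_canon (i : 'I_n) : \row_j Defs.canon i j = delta_mx 0 i :> 'rV[int]_n.
Proof. by apply/rowP => j; rewrite !mxE /Defs.canon eq_sym; case: eqVneq. Qed.

Lemma tits_bilin_canon r i j :
  bilin (tits_form src tgt r) (Defs.canon i) (Defs.canon j) =
  tits_mx r i j + tits_mx r j i.
Proof.
rewrite /bilin !tits_formE.
have -> : \row_l vadd (Defs.canon i) (Defs.canon j) l =
    delta_mx 0 i + delta_mx 0 j :> 'rV[int]_n.
  by rewrite -!row_canon; apply/rowP => l; rewrite !mxE.
by rewrite !row_canon qfD bf_unitv; lia.
Qed.

Lemma triangular_no_loop a : triangular src tgt -> src a != tgt a.
Proof.
move=> tri; have := tri (src a, [:: a]); rewrite /valid_path /endv /= eqxx.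
by move=> /(_ isT isT); rewrite eq_sym.
Qed.

Variables (k : fieldType) (I : kQfun n m k -> Prop) (N : nat) (R : 'I_N -> kQfun n m k).

(* A generator from [i] to [i] vanishes, as there are no oriented cycles, so it
   could be dropped from the generating set. *)
Lemma rel_count_diag i : triangular src tgt -> admissible src tgt I ->
  minimal_gen_set src tgt I R -> rel_count tgt I R i i = 0%N.
Proof.
move=> tri [idI [M [_ [_ IJ2]]]] [_ _ genR minR].
apply/eqP; rewrite cards_eq0; apply/eqP/setP => l; rewrite !inE.
apply/negP => /asboolP [Il hl]; apply: (minR l) => x.
have R0 : R l = @kQzero n m k.
  apply/funext => p; apply/eqP; rewrite -[_ == _]negbK; apply/negP => xp.
  have [p1 p2] := hl p xp; have [/(_ _ Il)[K hK] _ _ _ _] := idI.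
  have /andP[vp _] := hK p xp.
  (* A path in the support of [R l] is closed, hence trivial by triangularity, and trivial paths do
     not occur in elements of an ideal inside J^2. *)
  have := tri p vp; rewrite p1 p2 eqxx => h.
  case/negP: xp; apply/eqP/(IJ2 _ Il); case: (size p.2) h => // s /(_ isT).
  by [].
rewrite -genR; split=> gx J idJ hJ; apply: gx => // y [l'].
  by case=> _ ->; apply: hJ; exists l'.
move=> ->; have [->|ll'] := eqVneq l' l; first by rewrite R0; case: idJ.
by apply: hJ; exists l'.
Qed.

Lemma tits_mx_diag i : triangular src tgt -> admissible src tgt I ->
  minimal_gen_set src tgt I R -> tits_mx (rel_count tgt I R) i i = 1.
Proof.
move=> tri adm minR; rewrite mxE eqxx rel_count_diag // big1 => [|a _].
  by rewrite subr0 addr0.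
case: (eqVneq (src a) i) => //= e.
by have := triangular_no_loop a tri; rewrite e eq_sym => /negPf->.
Qed.

End TitsForm.

Theorem theorem0 (k : closedFieldType) (n m : nat) (src tgt : 'I_m -> 'I_n)
  (I : kQfun n m k -> Prop) (N : nat) (R : 'I_N -> kQfun n m k)
  (v : 'I_n -> int) :
  triangular src tgt ->
  admissible src tgt I ->
  minimal_gen_set src tgt I R ->
  slender (tits_form src tgt (rel_count tgt I R)) ->
  omnipresent v ->
  maximal_root (tits_form src tgt (rel_count tgt I R)) v ->
  weakly_nonneg (tits_form src tgt (rel_count tgt I R)) /\
  (forall i, v i <= 12).
Proof.
move=> tri adm minR slen v_gt0 [[_ qv] v_max].
set r := rel_count tgt I R; set C := tits_mx src tgt r.
have C1 i : C i i = 1 by apply: tits_mx_diag.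
have Cslen i j : i != j -> -1 <= C i j + C j i.
  by move=> ij; rewrite -tits_bilin_canon slen.
have V_gt0 i : 0 < (\row_j v j : 'rV[int]_n) 0 i by rewrite mxE.
have qV : qf C (\row_j v j) = 1 by rewrite -tits_formE.
have V_max w : nneg w -> qf C w = 1 -> (forall i, (\row_j v j) 0 i <= w 0 i) ->
    w = \row_j v j.
  move=> wnn qw hw; have rw : \row_j w 0 j = w by apply/rowP => j; rewrite mxE.
  apply/rowP => i; rewrite mxE; apply: (v_max (fun j => w 0 j)) => [|j].
    by split=> //; rewrite tits_formE rw.
  by have := hw j; rewrite mxE.
split=> [x xnn|i].
  rewrite tits_formE; apply: (qf_ge0 C1 Cslen V_gt0 qV V_max) => i.
  by rewrite mxE.
by have := root_bound C1 Cslen V_gt0 qV V_max i; rewrite mxE.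
Qed.
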